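(* Let $\rho>0$ and consider the Mallows culture on candidates $\{1,2,3\}$ with reference ranking $(1,2,3)$ and concentration parameter $\rho$, with $n$ independent voters. Let $\boldsymbol\zeta=(e^{-3\rho/2},e^{-\rho/2})$. Then, as $n\to+\infty$, \[ \mathbb{P}(3\text{ is the Condorcet winner})\sim\frac{P(\boldsymbol\zeta)^n}{\prod_{j\in\{1,2\}}\big((1-\zeta_j)\zeta_j^{\lceil n/2\rceil-1}\big)}\cdot\frac{1}{2\pi n\sqrt{\det(\mathcal{H}_K(\boldsymbol\tau))}}, \] where $P(\boldsymbol\zeta)=\dfrac{2e^{-2\rho}(1+e^{-\rho/2}+e^{-\rho})}{(1+e^{-\rho})(1+e^{-\rho}+e^{-2\rho})}$ and $\det(\mathcal{H}_K(\boldsymbol\tau))=\dfrac14\cdot\dfrac{e^{-\rho/2}(1+e^{-\rho})}{(1+e^{-\rho/2}+e^{-\rho})^2}$.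
   Context: Mallows culture with reference ranking $r_0$ and parameter $\rho$: each voter independently draws ranking $r$ with probability $\gamma e^{-\rho d(r,r_0)}$, $d$ the Kendall tau distance (number of discordant pairs), $\gamma$ normalizing. Candidate $3$ is the Condorcet winner if, for each $j\in\{1,2\}$, strictly more than $n/2$ voters rank $3$ above $j$. For $\mathcal{X}\subseteq\{1,2\}$, $p_{\mathcal{X}}$ is the probability that the set of candidates ranked above $3$ is exactly $\mathcal{X}$; $P(x_1,x_2)=\sum_{\mathcal{X}}p_{\mathcal{X}}\prod_{j\in\mathcal{X}}x_j$; $K(\mathbf{t})=\log P(e^{t_1},e^{t_2})$; $\boldsymbol\tau=(-3\rho/2,-\rho/2)=\log\boldsymbol\zeta$ and $\mathcal{H}_K(\boldsymbol\tau)$ is the Hessian of $K$ at $\boldsymbol\tau$. *)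

(* Defs.v *)
From HB Require Import structures.
From mathcomp Require Import all_boot all_order all_algebra all_fingroup.
From mathcomp Require Import all_classical all_reals all_analysis.
Set Implicit Arguments. Unset Strict Implicit. Unset Printing Implicit Defensive.
Import Order.TTheory GRing.Theory Num.Theory.
Import numFieldNormedType.Exports.
Local Open Scope ring_scope.

Definition cand1 : 'I_3 := ord0.
Definition cand2 : 'I_3 := inord 1.
Definition cand3 : 'I_3 := ord_max.

(* A ranking r : {perm 'I_3} maps each candidate c to its position r c
   (0 = top).  The reference ranking (1,2,3) is the identity permutation. *)
Definition ranking := {perm 'I_3}.
Definition ref_ranking : ranking := 1%g.

Definition above (r : ranking) (c c' : 'I_3) : bool := (r c < r c')%N.

Definition kendall (r s : ranking) : nat :=
  #|[set p : 'I_3 * 'I_3 | (p.1 < p.2)%N && (above r p.1 p.2 != above s p.1 p.2)]|.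

Definition mallows (R : realType) (rho : R) (r : ranking) : R :=
  expR (- rho * (kendall r ref_ranking)%:R) /
  \sum_(s : ranking) expR (- rho * (kendall s ref_ranking)%:R).

Definition profile (n : nat) := {ffun 'I_n -> ranking}.

Definition cw3 (n : nat) (v : profile n) : bool :=
  [forall j : 'I_3, (j \in [set cand1; cand2]) ==>
     (n < 2 * #|[set i : 'I_n | above (v i) cand3 j]|)%N].

Definition prob_cw3 (R : realType) (rho : R) (n : nat) : R :=
  \sum_(v : profile n | cw3 v) \prod_(i < n) mallows rho (v i).

Definition above3 (r : ranking) : {set 'I_3} := [set c | above r c cand3].

Definition pX (R : realType) (rho : R) (X : {set 'I_3}) : R :=
  \sum_(r : ranking | above3 r == X) mallows rho r.

Definition Ppoly (R : realType) (rho : R) (x1 x2 : R) : R :=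
  \sum_(X : {set 'I_3} | X \subset [set cand1; cand2])
     pX rho X * \prod_(j in X) (if j == cand1 then x1 else x2).

Definition Kfun (R : realType) (rho : R) (t1 t2 : R) : R :=
  ln (Ppoly rho (expR t1) (expR t2)).

Definition partial (R : realType) (i : 'I_2) (f : R -> R -> R) : R -> R -> R :=
  if i == ord0 then fun a b => derive1 (fun x => f x b) a
  else fun a b => derive1 (fun y => f a y) b.

Definition hessian (R : realType) (f : R -> R -> R) (a b : R) : 'M[R]_2 :=
  \matrix_(i < 2, j < 2) partial i (partial j f) a b.

Definition tau1 (R : realType) (rho : R) : R := - (3 * rho / 2).
Definition tau2 (R : realType) (rho : R) : R := - (rho / 2).
Definition zeta1 (R : realType) (rho : R) : R := expR (tau1 rho).
Definition zeta2 (R : realType) (rho : R) : R := expR (tau2 rho).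

Definition half_exp (n : nat) : int := (uphalf n)%:Z - 1.

(* Main.v *)
(* Tilting each voter's law by zeta turns the number of voters preferring
   candidate 1, resp. 2, to candidate 3 into a two-dimensional walk centred at n/2 and
   P(3 wins) into P(zeta)^n zeta^(1 - ceil(n/2)) times the geometrically weighted
   sum over i, j >= 0 of zeta_1^i zeta_2^j Q_n(m - i, m - j), where
   m = ceil(n/2) - 1 and Q_n is the law of the tilted walk.
   Under the tilted law, in which (0,0) and (1,1) have probability a/2 each and
   (1,0) and (0,1) have probability (1-a)/2 each, the rotated coordinates are
   two simple random walks run for N and n - N steps with N ~ Bin(n, a), so Q_n is
   a binomial mixture of products of binomial probabilities.  Wallis' product
   and the concentration of N give the local limit n Q_n -> 1/(pi sqrt(a(1-a))),
   and dominated convergence for the geometric weights concludes. *)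
Require Import Defs.
From HB Require Import structures.
From mathcomp Require Import all_boot all_order all_algebra all_fingroup.
From mathcomp Require Import all_classical all_reals all_analysis.
From mathcomp Require Import ring lra zify.
Import Order.TTheory GRing.Theory Num.Theory.
Import numFieldNormedType.Exports.
Local Open Scope ring_scope.
Set Implicit Arguments.
Unset Strict Implicit.

(** * Wallis product and return probabilities of the simple random walk *)

Section Wallis.
Variable R : realType.
Implicit Type x : R.

(** An antiderivative of [sin ^+ n], given by the reduction formula, so that Wallis integrals become
    differences of its values. *)
Fixpoint sin_pow_prim (n : nat) (x : R) : R :=
  match n with
  | 0%N => x
  | 1%N => - cos x
  | (m.+1 as k).+1 =>
      (k%:R * sin_pow_prim m x - cos x * sin x ^+ k) / k.+1%:R
  end.

Lemma is_derive_sin_pow_prim (n : nat) x :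
  is_derive x 1 (sin_pow_prim n) (sin x ^+ n).
Proof.
have [m] := ubnP n; elim: m n x => // m IH [|[|n]] x ltm.
- exact: is_derive_id.
- have -> : sin_pow_prim 1 = - (cos : R -> R) by [].
  by rewrite expr1 -[sin x]opprK; exact: is_deriveN.
have D := IH n x (ltnW ltm).
pose k := n.+1%:R : R.
have -> : sin_pow_prim n.+2 =
   (n.+2%:R^-1 *: (k *: sin_pow_prim n - cos * (sin ^+ n.+1))) :> (R -> R).
  by apply/funext => y; rewrite /= mulrC !fctE.
apply: is_derive_eq.
rewrite /= !fctE /GRing.scale /= -/k -[n.+2]addn1 natrD -/k.
have := cos2Dsin2 x; set c := cos x; set s := sin x => h.
have k0 : k + 1 != 0 by rewrite -[1]/(1%:R) -natrD pnatr_eq0.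
have -> : c * (k * s ^+ n * c) = k * s ^+ n * (1 - s ^+ 2) by rewrite -h; ring.
rewrite addn1 !exprS; clearbody k; field.
by [].
Qed.

Definition wallis (n : nat) : R := sin_pow_prim n (pi / 2) - sin_pow_prim n 0.

Lemma wallis0 : wallis 0 = pi / 2.
Proof. by rewrite /wallis /= subr0. Qed.

Lemma wallis1 : wallis 1 = 1.
Proof. by rewrite /wallis /= cos_pihalf cos0; ring. Qed.

Lemma wallisS n : wallis n.+2 = n.+1%:R / n.+2%:R * wallis n.
Proof.
have E y : sin_pow_prim n.+2 y =
  (n.+1%:R * sin_pow_prim n y - cos y * sin y ^+ n.+1) / n.+2%:R by [].
by rewrite /wallis !E cos_pihalf sin0 !exprS !mul0r !mulr0 !subr0; ring.
Qed.

(** [wallis n] is the integral of [sin ^+ n] over [[0, pi / 2]], and [sin ^+ n - sin ^+ n.+1] is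
    nonnegative there. The mean value theorem for the difference of antiderivatives turns this into
    the inequality. *)
Lemma wallis_nincr n : wallis n.+1 <= wallis n.
Proof.
have pi2 : 0 <= pi / 2 :> R by rewrite divr_ge0 ?pi_ge0.
pose f := sin_pow_prim n - sin_pow_prim n.+1.
have D x : is_derive x 1 f (sin x ^+ n - sin x ^+ n.+1).
  by apply: is_deriveB; exact: is_derive_sin_pow_prim.
have C : {within `[0, pi / 2 : R], continuous f}%classic.
  apply: derivable_within_continuous => x _.
  exact: (@ex_derive _ _ _ _ _ _ _ (D x)).
have [c] := MVT_segment pi2 (fun x _ => D x) C.
rewrite in_itv /= => /andP[c0 cpi] E.
have s0 : 0 <= sin c.
  apply: sin_ge0_pi; rewrite c0 (le_trans cpi)//.
  by have := pi_ge0 R; lra.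
have : 0 <= f (pi / 2) - f 0.
  rewrite E subr0 mulr_ge0 // exprS -{1}[sin c ^+ n]mul1r -mulrBl.
  by rewrite mulr_ge0 ?exprn_ge0 // subr_ge0 sin_le1.
rewrite /f /wallis !fctE; lra.
Qed.

(* The law at [d] of a simple random walk after [N] steps. *)
Definition walk (N d : nat) : R :=
  if odd (N + d) then 0 else 'C(N, (N + d)./2)%:R / 2 ^+ N.

Lemma walk_ge0 N d : 0 <= walk N d.
Proof. by rewrite /walk; case: ifP => // _; rewrite divr_ge0 ?exprn_ge0. Qed.

Lemma walk_odd N d : odd (N + d) -> walk N d = 0.
Proof. by rewrite /walk => ->. Qed.

(** The ratio of consecutive binomial coefficients. It drives the inductions on [d], which advance
    by two because parity is preserved. *)
Lemma walkSS N d :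
  (N + d).+2%:R * walk N d.+2 = (N%:R - d%:R) * walk N d.
Proof.
rewrite /walk !addnS /= negbK; case: ifPn => [_|ev]; first by rewrite !mulr0.
set l := (N + d)./2.
have El : (N + d = l + l)%N by rewrite /l; lia.
have H : (l.+1 * 'C(N, l.+1) = (N - l) * 'C(N, l))%N.
  by rewrite mul_bin_left.
have H' : l.+1%:R * 'C(N, l.+1)%:R = (N%:R - l%:R) * 'C(N, l)%:R :> R.
  have [lN|Nl] := leqP l N.
    by rewrite -natrB // -!natrM H.
  by rewrite !bin_small ?mulr0 // ltnW.
rewrite !mulrA; congr (_ / _).
have -> : (N + d).+2%:R = 2 * l.+1%:R :> R.
  by rewrite El -natrM; congr (_%:R); lia.
have -> : N%:R - d%:R = 2 * (N%:R - l%:R) :> R.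
  by have : (N + d)%:R = (l + l)%:R :> R by [rewrite El]; rewrite !natrD; lra.
by rewrite -!mulrA H'.
Qed.


(** To be at 0 after [N.+1] steps, the walk must come from 1 or -1, which are equally likely. This
    provides the base case [d = 1] of the inductions by two. *)
Lemma walk1 N : walk N 1 = walk N.+1 0.
Proof.
rewrite /walk addn1 addn0 /=; case: ifPn => // ev.
set k := N./2; have -> : N = k.*2.+1 by rewrite /k; lia.
have -> : uphalf k.*2.+1 = k.+1 by lia.
have E : 'C(k.*2.+1, k) = 'C(k.*2.+1, k.+1).
  by rewrite -bin_sub; [congr 'C(_, _); lia|lia].
rewrite [in RHS]binS E natrD [in RHS]exprS; move: ('C(_, _)%:R) => x; field.
by rewrite expf_neq0.
Qed.

Lemma walk_central0 : walk 0 0 = 1.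
Proof. by rewrite /walk /= bin0 expr0 divr1. Qed.

Lemma walk_centralS k :
  walk k.+1.*2 0 = (k.*2.+1)%:R / (k.*2.+2)%:R * walk k.*2 0.
Proof.
rewrite /walk !addn0 !odd_double !doubleK doubleS.
have E1 : (k.+1 * 'C(k.*2.+2, k.+1) = k.*2.+2 * 'C(k.*2.+1, k.+1))%N.
  rewrite -mul_bin_diag; congr (_ * _)%N.
  by rewrite -[RHS]bin_sub; [congr 'C(_, _); lia|lia].
have E2 : (k.+1 * 'C(k.*2.+1, k.+1) = k.*2.+1 * 'C(k.*2, k))%N.
  by rewrite -mul_bin_diag.
have E : (k.+1 * 'C(k.*2.+2, k.+1) = 2 * (k.*2.+1 * 'C(k.*2, k)))%N.
  by rewrite E1 -E2; lia.
have {E} : k.+1%:R * 'C(k.*2.+2, k.+1)%:R = 2 * (k.*2.+1%:R * 'C(k.*2, k)%:R) :> R.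
  by rewrite -!natrM E.
have -> : k.*2.+2%:R = 2 * k.+1%:R :> R by rewrite -natrM; congr _%:R; lia.
have k0 : k.+1%:R != 0 :> R by rewrite pnatr_eq0.
have e0 : 2 ^+ k.*2 != 0 :> R by rewrite expf_neq0.
move=> E; apply: (mulfI k0).
rewrite !exprS.
rewrite [LHS]mulrA E.
move: (k.*2.+1%:R) ('C(_, _)%:R) (k.+1%:R) k0 => x y z z0; field.
by rewrite z0 ?e0 ?expf_neq0.
Qed.

Lemma walk_central_gt0 k : 0 < walk k.*2 0.
Proof.
elim: k => [|k IH]; first by rewrite walk_central0.
by rewrite walk_centralS mulr_gt0 // divr_gt0.
Qed.

(** Both sides obey the same recursion, starting from [wallis 0 = pi / 2]; this is how [pi] enters
    the return probabilities. *)
Lemma wallis_even k : wallis k.*2 = walk k.*2 0 * (pi / 2).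
Proof.
elim: k => [|k IH]; first by rewrite wallis0 walk_central0 mul1r.
by rewrite walk_centralS doubleS wallisS IH -!mulrA.
Qed.

Lemma wallis_odd k : wallis k.*2.+1 = (k.*2.+1%:R * walk k.*2 0)^-1.
Proof.
elim: k => [|k IH]; first by rewrite wallis1 walk_central0 mul1r invr1.
rewrite walk_centralS doubleS wallisS IH.
have /lt0r_neq0 := walk_central_gt0 k; move: (walk _ _) => w w0.
have : k.*2.+1%:R != 0 :> R by []; have : k.*2.+2%:R != 0 :> R by [].
have : k.*2.+3%:R != 0 :> R by [].
move: (_%:R) (_%:R) (_%:R) => x y z x0 y0 z0; field.
by rewrite w0 x0 y0 z0.
Qed.

(* Both bounds come from [wallis k.*2.+2 <= wallis k.*2.+1 <= wallis k.*2]. *)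
Lemma walk_central_bounds k :
  2 / pi <= k.*2.+1%:R * walk k.*2 0 ^+ 2 <= 2 / pi * (1 + k.*2.+1%:R^-1).
Proof.
have p0 := pi_gt0 R; have w0 := walk_central_gt0 k.
have k0 : 0 < k.*2.+1%:R :> R by [].
have := wallis_nincr k.*2; have := wallis_nincr k.*2.+1.
rewrite -doubleS !wallis_even wallis_odd walk_centralS.
have -> : k.*2.+2%:R = k.*2.+1%:R + 1 :> R by rewrite -natr1.
move: k0 w0; set x := _%:R; set w := walk _ _ => k0 w0.
have xw : 0 < x * w by rewrite mulr_gt0.
have k1 : 0 < x + 1 by rewrite addr_gt0.
rewrite -(ler_pM2r xw) mulVf ?gt_eqF // => h1.
rewrite -(ler_pM2r xw) mulVf ?gt_eqF // => h2.
apply/andP; split.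
  by rewrite ler_pdivrMr //; move: h2; rewrite expr2; lra.
have -> : x * w ^+ 2 = (x / (x + 1) * w * (pi / 2) * (x * w)) *
    (2 / pi * (1 + x^-1)).
  have := k1; have := k0; have := p0; clearbody x w; move: pi => p ? ? ?.
  by field; rewrite !gt_eqF.
rewrite -[X in _ <= X]mul1r ler_wpM2r // mulr_ge0 ?divr_ge0 ?ltW //.
by rewrite addr_gt0 // invr_gt0.
Qed.

(** With [x = k.*2.+1], the induction step multiplies the left side by [x * (x + 2) / (x + 1) ^+ 2],
    which is at most 1. *)
Lemma walk_bound_central N : N.+1%:R * walk N 0 ^+ 2 <= 1.
Proof.
have [oN|] := boolP (odd N); first by rewrite walk_odd ?addn0 // expr0n mulr0.
move=> /even_halfK <-; move: N./2 => {}k.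
elim: k => [|k IH]; first by rewrite walk_central0 expr1n mulr1.
apply: le_trans IH; rewrite walk_centralS exprMn mulrA.
apply: ler_wpM2r; first by rewrite exprn_ge0 // walk_ge0.
have -> : k.+1.*2.+1%:R = k.*2.+1%:R + 2 :> R by rewrite doubleS -!natr1; ring.
have -> : k.*2.+2%:R = k.*2.+1%:R + 1 :> R by rewrite -natr1.
have : 0 < k.*2.+1%:R :> R by [].
move: (_%:R) => x x0; have x1 : 0 < (x + 1) ^+ 2 by rewrite exprn_gt0 // addr_gt0.
by rewrite exprMn exprVn mulrA ler_pdivrMr //; nra.
Qed.

(** By [walkSS] the law decreases when [d] grows by two, as [N - d <= N + d + 2]; thus everything
    reduces to [d = 0], or to [d = 1] and then to [d = 0] one step later. *)
Lemma walk_bound N d : N.+1%:R * walk N d ^+ 2 <= 1.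
Proof.
elim/ltn_ind: d => -[|[|d]] IH; first exact: walk_bound_central.
  rewrite walk1; apply: le_trans (walk_bound_central N.+1).
  by rewrite ler_wpM2r ?exprn_ge0 ?walk_ge0 // ler_nat.
apply: le_trans (IH d (leqnSn _)); apply: ler_wpM2l => //.
rewrite ler_pXn2r ?nnegrE ?walk_ge0 //.
have [dN|Nd] := leqP d N; last first.
  rewrite {1}/walk; case: ifP => [_|ev]; first exact: walk_ge0.
  by rewrite bin_small ?mul0r ?walk_ge0 //; lia.
rewrite -(ler_pM2l (_ : 0 < (N + d).+2%:R)) // walkSS.
by apply: ler_wpM2r; rewrite ?walk_ge0 // -natrB // ler_nat; lia.
Qed.

Definition walk_scaled (d N : nat) : R := Num.sqrt N.+1%:R * walk N d.

Lemma walk_scaled_ge0 d N : 0 <= walk_scaled d N.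
Proof. by rewrite mulr_ge0 ?sqrtr_ge0 ?walk_ge0. Qed.

Lemma walk_scaled_le1 d N : walk_scaled d N <= 1.
Proof.
rewrite -(@ler_pXn2r _ 2) ?nnegrE ?walk_scaled_ge0 // expr1n exprMn sqr_sqrtr //.
exact: walk_bound.
Qed.

Local Notation kappa := (Num.sqrt (2 / pi) : R).

(** The error in the one-dimensional local limit: [kappa] is the limit along the times at which [d]
    can be reached, and the law vanishes at the other times. *)
Definition parity_gap (d N : nat) : R :=
  walk_scaled d N - kappa * (~~ odd (N + d))%:R.

(** The square root of [walk_central_bounds], with [1 + x <= (1 + x) ^+ 2] used to remove the root
    from the correction factor. *)
Lemma parity_gap0_bound N : `|parity_gap 0 N| <= kappa * N.+1%:R^-1.
Proof.
rewrite /parity_gap addn0; have [oN|] := boolP (odd N).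
  rewrite /walk_scaled walk_odd ?addn0 // !mulr0 subr0 normr0.
  by rewrite mulr_ge0 ?sqrtr_ge0.
move=> /even_halfK <-; move: N./2 => {}k.
rewrite mulr1.
have /andP[h1 h2] := walk_central_bounds k.
have E : walk_scaled 0 k.*2 = Num.sqrt (k.*2.+1%:R * walk k.*2 0 ^+ 2).
  by rewrite sqrtrM // sqrtr_sqr ger0_norm ?walk_ge0.
have l : kappa <= walk_scaled 0 k.*2 by rewrite E ler_wsqrtr.
rewrite ger0_norm ?subr_ge0 // lerBlDl E.
have p0 : 0 <= kappa := sqrtr_ge0 _.
have p1 : 0 <= 2 / pi :> R by rewrite divr_ge0 ?pi_ge0.
have i0 : 0 <= k.*2.+1%:R^-1 :> R by rewrite invr_ge0.
rewrite -{1}[kappa]mulr1 -mulrDr.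
have k1 : 0 <= 1 + k.*2.+1%:R^-1 :> R by rewrite addr_ge0.
rewrite -[1 + _](ger0_norm k1) -sqrtr_sqr -sqrtrM //.
apply: ler_wsqrtr; apply: (le_trans h2); apply: ler_wpM2l => //.
by rewrite expr2 ler_peMr // lerDl.
Qed.

(** Induction on [d] by two. The case [d = 1] is the case 0 at time [N.+1], up to the change of
    scale from [N.+2] to [N.+1]. *)
Lemma parity_gap_rate d :
  exists2 C : R, 0 <= C & forall N, `|parity_gap d N| <= C * N.+1%:R^-1.
Proof.
have k0 : 0 <= kappa := sqrtr_ge0 _.
elim/ltn_ind: d => -[|[|d]] IH.
- by exists kappa => // N; exact: parity_gap0_bound.
- exists (kappa + 1) => [|N]; first by rewrite addr_ge0.
  have -> : parity_gap 1 N = parity_gap 0 N.+1 -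
      (Num.sqrt N.+2%:R - Num.sqrt N.+1%:R) * walk N.+1 0.
    by rewrite /parity_gap /walk_scaled walk1 addn1 addn0; ring.
  rewrite (le_trans (ler_normB _ _)) // [leRHS]mulrDl lerD //.
    rewrite (le_trans (parity_gap0_bound _)) // ler_wpM2l //.
    by rewrite lef_pV2 ?posrE // ler_nat.
  have st : Num.sqrt N.+1%:R <= Num.sqrt N.+2%:R :> R.
    by rewrite ler_wsqrtr // ler_nat.
  have s2 : Num.sqrt N.+2%:R ^+ 2 = N.+1%:R + 1 :> R by rewrite sqr_sqrtr // natr1.
  have t2 : Num.sqrt N.+1%:R ^+ 2 = N.+1%:R :> R by rewrite sqr_sqrtr.
  have t0 : 0 < Num.sqrt N.+1%:R :> R by rewrite sqrtr_gt0.
  have := walk_scaled_le1 0 N.+1; rewrite /walk_scaled.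
  have := walk_ge0 N.+1 0.
  rewrite ger0_norm; last by rewrite mulr_ge0 ?walk_ge0 // subr_ge0.
  rewrite mul1r -[X in _ <= X^-1]t2; move: st s2 t0; rewrite -[X in X + 1]t2.
  move: (Num.sqrt _) (Num.sqrt _) (walk _ _) => s t w st s2 t0 w0 w1.
  have tt : 0 < t ^+ 2 by rewrite exprn_gt0.
  rewrite -(ler_pM2r tt) mulVf ?gt_eqF //.
  (* From [s ^+ 2 = t ^+ 2 + 1] and [t <= s] follows [s * (s - t) = 1 - t * (s - t) <= 1]. *)
  have h1 : 0 <= s * (s - t) <= 1 by rewrite mulr_ge0 ?subr_ge0 ?(le_trans (ltW t0)) //; nra.
  have h2 : 0 <= s * w by rewrite mulr_ge0 // (le_trans (ltW t0)).
  have h3 : s * (s - t) * (s * w) <= 1.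
    by case/andP: h1 => ? ?; rewrite mulr_ile1.
  apply: le_trans h3; have : 0 <= (s - t) * w by rewrite mulr_ge0 ?subr_ge0.
  nra.
have [C C0 HC] := IH d (leqnSn _).
exists (C + d.*2.+2%:R) => [|N]; first by rewrite addr_ge0.
have N0 : (N + d).+2%:R != 0 :> R by [].
(* By [walkSS] the quotient of the two laws is [(N - d) / (N + d + 2) = 1 - (2 * d + 2) / (N + d +
   2)], so the gap changes by order [1 / N]. *)
have -> : parity_gap d.+2 N = parity_gap d N -
    d.*2.+2%:R * (N + d).+2%:R^-1 * walk_scaled d N.
  rewrite /parity_gap /walk_scaled !addnS /= negbK.
  have -> : walk N d.+2 = (N + d).+2%:R^-1 * (N%:R - d%:R) * walk N d.
    by rewrite -mulrA -walkSS mulrA mulVf ?mul1r.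
  have -> : N%:R = (N + d).+2%:R - d%:R - 2 :> R by rewrite -!natr1 natrD; ring.
  have -> : d.*2.+2%:R = d%:R + d%:R + 2 :> R by rewrite -!natr1 -addnn natrD; ring.
  move: N0; move: (_.+2%:R) (Num.sqrt _) => x t x0.
  by field.
rewrite (le_trans (ler_normB _ _)) // [leRHS]mulrDl lerD // ger0_norm; last first.
  by rewrite mulr_ge0 ?walk_scaled_ge0 // divr_ge0.
rewrite -mulrA ler_wpM2l // -[X in _ <= X]mulr1 ler_pM ?walk_scaled_ge0 ?walk_scaled_le1 //.
by rewrite lef_pV2 ?posrE // ler_nat; lia.
Qed.

End Wallis.

(** * Binomial expectations *)

Section BinomialExpectation.
Variable R : realType.
Implicit Types (a x y : R) (f g : nat -> R).

Definition binE a (n : nat) f : R :=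
  \sum_(N < n.+1) 'C(n, N)%:R * a ^+ N * (1 - a) ^+ (n - N) * f N.

Lemma binE_ext a n f g :
  (forall N, (N <= n)%N -> f N = g N) -> binE a n f = binE a n g.
Proof. by move=> fg; apply: eq_bigr => N _; rewrite fg // -ltnS. Qed.

Lemma binE_pow a n x : binE a n (fun N => x ^+ N) = (a * x + (1 - a)) ^+ n.
Proof.
rewrite addrC exprDn; apply: eq_bigr => N _.
by rewrite exprMn -mulr_natl; ring.
Qed.

Lemma binE_cst a n x : binE a n (fun=> x) = x.
Proof.
have := binE_pow a n 1; rewrite mulr1 addrC subrK expr1n => E.
rewrite -[RHS]mul1r -E mulr_suml; apply: eq_bigr => N _.
by rewrite expr1n mulr1.
Qed.

Lemma binED a n f g : binE a n (fun N => f N + g N) = binE a n f + binE a n g.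
Proof. by rewrite -big_split; apply: eq_bigr => N _; rewrite mulrDr. Qed.

Lemma binEZ a n x f : binE a n (fun N => x * f N) = x * binE a n f.
Proof. by rewrite mulr_sumr; apply: eq_bigr => N _; rewrite mulrCA. Qed.

Lemma binE_rev a n f : binE a n (fun N => f (n - N)%N) = binE (1 - a) n f.
Proof.
rewrite /binE (reindex_inj rev_ord_inj) /=; apply: eq_bigr => N _.
have Nn : (N <= n)%N by rewrite -ltnS.
rewrite subSS bin_sub // subKn // subKr.
by rewrite -!mulrA; congr (_ * _); rewrite mulrCA.
Qed.

(** Size biasing, from [N * 'C(n.+1, N) = n.+1 * 'C(n, N.-1)]. The moments and the inverse moments
    below all come from it. *)
Lemma binE_size_bias a n f :
  binE a n.+1 (fun N => N%:R * f N) = n.+1%:R * a * binE a n (fun N => f N.+1).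
Proof.
rewrite /binE big_ord_recl /= mul0r mulr0 add0r mulr_sumr.
apply: eq_bigr => N _; rewrite /bump /= add1n subSS exprS.
have : n.+1%:R * 'C(n, N)%:R = N.+1%:R * 'C(n.+1, N.+1)%:R :> R.
  by rewrite -!natrM mul_bin_diag.
move: (n.+1%:R) ('C(n, N)%:R) (N.+1%:R) ('C(n.+1, N.+1)%:R) => x y z t h.
transitivity (z * t * (a * a ^+ N * (1 - a) ^+ (n - N) * f N.+1)); first by ring.
by rewrite -h; ring.
Qed.

Section Positive.
Variable a : R.
Hypotheses (a0 : 0 < a) (a1 : a < 1).
Let b0 : 0 < 1 - a. Proof. by rewrite subr_gt0. Qed.

Lemma ler_binE n f g :
  (forall N, (N <= n)%N -> f N <= g N) -> binE a n f <= binE a n g.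
Proof.
move=> fg; apply: ler_sum => N _; apply: ler_wpM2l; last by rewrite fg // -ltnS.
by rewrite !mulr_ge0 ?exprn_ge0 // ltW.
Qed.

Lemma binE_ge0 n f : (forall N, (N <= n)%N -> 0 <= f N) -> 0 <= binE a n f.
Proof. by move=> f0; rewrite -(binE_cst a n 0); exact: ler_binE. Qed.

Lemma ler_norm_binE n f : `|binE a n f| <= binE a n (fun N => `|f N|).
Proof.
apply: le_trans (ler_norm_sum _ _ _) _; apply: ler_sum => N _.
rewrite normrM ger0_norm //.
by rewrite !mulr_ge0 ?exprn_ge0 // ltW.
Qed.

(** Size biasing with [f N = N^-1]: the product [N * N^-1] is 1, except at [N = 0] where the
    convention [0^-1 = 0] makes it 0. *)
Lemma binE_inv_le n : binE a n (fun N => N.+1%:R^-1) <= (n.+1%:R * a)^-1.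
Proof.
have na : 0 < n.+1%:R * a by rewrite mulr_gt0.
rewrite -(ler_pM2l na) mulfV ?gt_eqF // -(binE_size_bias a n (fun N => N%:R^-1)).
rewrite -[leRHS](binE_cst a n.+1); apply: ler_binE => -[|N] _.
  by rewrite mul0r.
by rewrite mulfV.
Qed.

Lemma binE_mean n : binE a n (fun N => N%:R) = n%:R * a.
Proof.
case: n => [|n]; first by rewrite /binE big_ord1 mulr0 mul0r.
rewrite -[RHS]mulr1 -[X in _ * X](binE_cst a n) -(binE_size_bias a n (fun=> 1)).
by apply: binE_ext => N _; rewrite mulr1.
Qed.

Lemma binE_prod n :
  binE a n (fun N => N%:R * (n%:R - N%:R)) = n%:R * (n%:R - 1) * (a * (1 - a)).
Proof.
case: n => [|n]; first by rewrite /binE big_ord1 /= !mul0r !mulr0.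
rewrite (binE_size_bias a n (fun N => n.+1%:R - N%:R)).
rewrite (@binE_ext _ _ _ (fun N => n%:R + -1 * N%:R)); last first.
  by move=> N _; rewrite -!natr1; ring.
rewrite binED binE_cst binEZ binE_mean -!natr1; ring.
Qed.

End Positive.

(** * Concentration of the random normalization of the two walks *)

Section LocalLimit.
Variable a : R.
Hypotheses (a0 : 0 < a) (a1 : a < 1).
Let b0 : 0 < 1 - a. Proof. by rewrite subr_gt0. Qed.

(** Equivalent to [n], but chosen to cancel exactly the factors [n.+1] and [n.+2] that arise from
    size biasing twice. *)
Definition llt_scale (n : nat) : R := Num.sqrt (n.+1%:R * n.+2%:R).
Definition llt_ratio (n N : nat) : R :=
  llt_scale n / (Num.sqrt N.+1%:R * Num.sqrt (n - N).+1%:R).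
Local Notation c := (Num.sqrt (a * (1 - a)))^-1.

Lemma llt_scale_gt0 n : 0 < llt_scale n.
Proof. by rewrite sqrtr_gt0 mulr_gt0. Qed.

Lemma llt_ratio_gt0 n N : 0 < llt_ratio n N.
Proof. by rewrite divr_gt0 ?llt_scale_gt0 // mulr_gt0 ?sqrtr_gt0. Qed.

Lemma llt_ratio_sqr n N :
  llt_ratio n N ^+ 2 = n.+1%:R * n.+2%:R * (N.+1%:R^-1 * (n - N).+1%:R^-1).
Proof. by rewrite exprMn exprVn exprMn !sqr_sqrtr ?mulr_ge0 // invfM. Qed.

Lemma llt_const_sqr : c ^+ 2 = (a * (1 - a))^-1.
Proof. by rewrite exprVn sqr_sqrtr // mulr_ge0 ?ltW. Qed.

(** One size biasing absorbs [N.+1%:R^-1]; after the reversal [N -> n - N], which exchanges [a] and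
    [1 - a], [binE_inv_le] bounds the other inverse. *)
Lemma binE_ratio_sqr_le n : binE a n (fun N => llt_ratio n N ^+ 2) <= c ^+ 2.
Proof.
rewrite llt_const_sqr; under [X in binE _ _ X]eq_fun => N do rewrite llt_ratio_sqr.
rewrite binEZ -[n.+1%:R * _ * _]mulrA mulrCA.
have h : n.+1%:R * a * binE a n (fun N => N.+1%:R^-1 * (n - N).+1%:R^-1)
   <= (n.+2%:R * (1 - a))^-1.
  (* The indices are shifted so that [f N.+1] is the integrand wanted at [n]. *)
  pose f N : R := N%:R^-1 * (n.+1 - N).+1%:R^-1.
  rewrite -(binE_size_bias a n f).
  have le1 : binE (1 - a) n.+1 (fun N => N.+1%:R^-1) <= (n.+2%:R * (1 - a))^-1.
    by apply: binE_inv_le => //; rewrite ltrBlDr ltrDl.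
  apply: le_trans le1; rewrite -binE_rev; apply: ler_binE => // -[|N] _.
    by rewrite mul0r.
  by rewrite mulrA mulfV // mul1r.
rewrite -(ler_pM2r a0) (_ : (_ * _)^-1 * a = (1 - a)^-1); last first.
  by field; rewrite !gt_eqF.
have n2 : 0 < n.+2%:R :> R by [].
have -> : (1 - a)^-1 = n.+2%:R * (n.+2%:R * (1 - a))^-1.
  by rewrite invfM mulrA mulfV // mul1r.
apply: le_trans (ler_wpM2l (ltW n2) h).
by rewrite le_eqVlt; apply/orP; left; apply/eqP; ring.
Qed.

(** The inverse square is a polynomial in [N], since [(N + 1) * (n - N + 1) = N * (n - N) + n + 1];
    its mean is given by [binE_prod], and the term [n + 1] leaves [n.+2%:R^-1]. *)
Lemma binE_ratio_inv_sqr_le n :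
  binE a n (fun N => llt_ratio n N ^- 2) <= a * (1 - a) + n.+2%:R^-1.
Proof.
have n1 : 0 < n.+1%:R :> R by []. have n2 : 0 < n.+2%:R :> R by [].
rewrite (@binE_ext _ _ _ (fun N => (n.+1%:R * n.+2%:R)^-1 *
    (N%:R * (n%:R - N%:R) + n.+1%:R))); last first.
  move=> N Nn; rewrite llt_ratio_sqr invfM [X in _ * X]invfM !invrK; congr (_ * _).
  by rewrite -!natr1 natrB //; ring.
rewrite binEZ binED binE_cst binE_prod.
rewrite -(ler_pM2l (mulr_gt0 n1 n2)) mulrA mulfV ?gt_eqF ?mulr_gt0 // mul1r.
have -> : n.+1%:R * n.+2%:R * (a * (1 - a) + n.+2%:R^-1) =
    n.+1%:R * n.+2%:R * (a * (1 - a)) + n.+1%:R.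
  move: n2 => /lt0r_neq0; move: (n.+2%:R) (n.+1%:R) => x y x0; field.
  by rewrite x0.
rewrite lerD2r.
apply: ler_wpM2r; first by rewrite mulr_ge0 ?ltW.
by rewrite -!natr1; have := ler0n R n; nra.
Qed.

(* The tangent bound [X >= c (3/2 - c^2 X^-2 / 2)] turns control of the second
   moments of X and 1/X into L^2 concentration of X at c. *)
Lemma binE_ratio_dist_sqr_le n :
  binE a n (fun N => (llt_ratio n N - c) ^+ 2) <= c ^+ 4 * n.+2%:R^-1.
Proof.
have c0 : 0 < c by rewrite invr_gt0 sqrtr_gt0 mulr_gt0.
apply: (@le_trans _ _ (binE a n (fun N => llt_ratio n N ^+ 2 +
    (c ^+ 4 * llt_ratio n N ^- 2 + - 2 * c ^+ 2)))).
  apply: ler_binE => // N _; move: (llt_ratio_gt0 n N).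
  move: (llt_ratio n N) c c0 => X k k0 X0.
  have X2 : 0 < X ^+ 2 by rewrite exprn_gt0.
  rewrite -subr_ge0.
  have -> : X ^+ 2 + (k ^+ 4 * X ^- 2 + - 2 * k ^+ 2) - (X - k) ^+ 2 =
     k * (X - k) ^+ 2 * (2 * X + k) / X ^+ 2.
    by field; rewrite gt_eqF.
  have Xk : 0 < 2 * X + k by rewrite addr_gt0 // mulr_gt0.
  apply: divr_ge0 (ltW X2); apply: mulr_ge0 (ltW Xk).
  exact: mulr_ge0 (ltW k0) (sqr_ge0 _).
rewrite !binED binEZ binE_cst.
have h1 := binE_ratio_sqr_le n.
have h2 := ler_wpM2l (ltW (exprn_gt0 4 c0)) (binE_ratio_inv_sqr_le n).
have e : c ^+ 4 * (a * (1 - a)) = c ^+ 2.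
  rewrite -[4%N]/(2 + 2)%N exprD {1}llt_const_sqr mulrC mulrA mulfV ?mul1r //.
  by rewrite gt_eqF // mulr_gt0.
have := h1; have := h2; have := e.
move: (c ^+ 4) (c ^+ 2) (n.+2%:R^-1) (binE _ _ _) (binE _ _ _) => x y z t u e' i1 i2.
rewrite mulrDr e' in i1; lra.
Qed.

End LocalLimit.
End BinomialExpectation.

(** * Local limit theorem *)

Lemma norm_one_subM2_lt1 (R : realType) (a : R) :
  0 < a -> a < 1 -> `|1 - 2 * a| < 1.
Proof. by move=> a0 a1; rewrite ltr_norml; apply/andP; split; lra. Qed.

Section LocalLimitTheorem.
Variable R : realType.
Variable a : R.
Local Notation c := (Num.sqrt (a * (1 - a)))^-1.
Local Notation kappa := (Num.sqrt (2 / pi) : R).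

(* Each step moves the first walk with probability [a], the second otherwise. *)
Definition walk2 (n d1 d2 : nat) : R :=
  binE a n (fun N => walk R N d1 * walk R (n - N) d2).

Lemma walk2_odd n d1 d2 : odd (n + d1 + d2) -> walk2 n d1 d2 = 0.
Proof.
move=> o; rewrite -(binE_cst a n 0); apply: binE_ext => N Nn.
have [h1|h1] := boolP (odd (N + d1)); first by rewrite walk_odd ?mul0r.
by rewrite [X in _ * X]walk_odd ?mulr0 //; lia.
Qed.

Hypotheses (a0 : 0 < a) (a1 : a < 1).
Let b0 : 0 < 1 - a. Proof. by rewrite subr_gt0. Qed.

Lemma walk2_scaled n d1 d2 : llt_scale R n * walk2 n d1 d2 =
  binE a n (fun N =>
    walk_scaled R d1 N * walk_scaled R d2 (n - N) * llt_ratio R n N).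
Proof.
rewrite /walk2 -binEZ; apply: binE_ext => N _.
rewrite /walk_scaled /llt_ratio.
have : Num.sqrt N.+1%:R != 0 :> R by rewrite gt_eqF // sqrtr_gt0.
have : Num.sqrt (n - N).+1%:R != 0 :> R by rewrite gt_eqF // sqrtr_gt0.
move: (Num.sqrt _) (Num.sqrt _) (llt_scale _ _) => s t u s0 t0; field.
by rewrite s0 t0.
Qed.

Lemma walk2_ge0 n d1 d2 : 0 <= walk2 n d1 d2.
Proof. by apply: binE_ge0 => // N _; rewrite mulr_ge0 ?walk_ge0. Qed.

(** Both scaled walks are at most 1, and the ratio [X] satisfies [X <= 1 + X ^+ 2]. Uniformity in
    [n], [d1] and [d2] makes this the dominating constant later. *)
Lemma walk2_scaled_bound n d1 d2 :
  llt_scale R n * walk2 n d1 d2 <= 1 + c ^+ 2.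
Proof.
rewrite walk2_scaled; have := binE_ratio_sqr_le a0 a1 n.
rewrite -(lerD2l 1) -[X in X + _ <= _ -> _](binE_cst a n) -binED.
apply: le_trans; apply: ler_binE => // N _.
have X0 := llt_ratio_gt0 R n N.
apply: (@le_trans _ _ (llt_ratio R n N)).
  rewrite ler_piMl ?(ltW X0) // mulr_ile1 ?walk_scaled_ge0 //;
    exact: walk_scaled_le1.
by move: (llt_ratio _ _ _) X0 => x; nra.
Qed.

(** From the second moment to the first by [x <= s^-1 + s * x ^+ 2]; the choice
    [s = Num.sqrt n.+2%:R] gives both terms the same order. *)
Lemma binE_ratio_dist_le n : binE a n (fun N => `|llt_ratio R n N - c|) <=
  (1 + c ^+ 4) * (Num.sqrt n.+2%:R)^-1.
Proof.
set s := Num.sqrt n.+2%:R; have s0 : 0 < s by rewrite sqrtr_gt0.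
have ss : s ^+ 2 = n.+2%:R by rewrite sqr_sqrtr.
apply: (@le_trans _ _ (binE a n (fun N => s^-1 + s * (llt_ratio R n N - c) ^+ 2))).
  apply: ler_binE => // N _; have <- : `|llt_ratio R n N - c| ^+ 2 = (llt_ratio R n N - c) ^+ 2.
    by rewrite real_normK ?num_real.
  move: `|_| (normr_ge0 (llt_ratio R n N - c)) => x x0.
  rewrite -(ler_pM2l s0) mulrDr mulfV ?gt_eqF //.
  have : 0 <= s * x by rewrite mulr_ge0 // ltW.
  by rewrite mulrA -expr2 -exprMn; move: (s * x) => y; nra.
rewrite binED binE_cst binEZ mulrDl mul1r lerD2l.
have := ler_wpM2l (ltW s0) (binE_ratio_dist_sqr_le a0 a1 n).
rewrite -ss => h; apply: (le_trans h).
rewrite mulrCA; rewrite le_eqVlt; apply/orP; left; apply/eqP; congr (_ * _).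
by field; rewrite gt_eqF.
Qed.

(** The indicator of an even number is [(1 + (-1) ^+ (N + d)) / 2], and [binE_pow] at -1 gives the
    mean. The bias [(1 - 2 * a) ^+ n] dies out geometrically. *)
Lemma binE_parity n d :
  binE a n (fun N => (~~ odd (N + d))%:R) =
  (1 + (-1) ^+ d * (1 - 2 * a) ^+ n) / 2.
Proof.
rewrite (@binE_ext _ _ _ _ (fun N => 2^-1 + (2^-1 * (-1) ^+ d) * (-1) ^+ N)).
  rewrite binED binE_cst binEZ binE_pow.
  have -> : a * -1 + (1 - a) = 1 - 2 * a by ring.
  by field.
move=> N _; rewrite -mulrA -exprD addnC -signr_odd.
by case: odd => /=; rewrite ?expr0 ?expr1; field.
Qed.

(** The three error terms come from the concentration of the ratio, from the averaged local limit
    errors of the two walks, and from the parity bias of [N]. *)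
Lemma walk2_error d1 d2 : exists2 K : R, 0 <= K & forall n,
  `|llt_scale R n * walk2 n d1 d2 - c / pi * (~~ odd (n + d1 + d2))%:R| <=
    K * ((Num.sqrt n.+2%:R)^-1 + n.+1%:R^-1 + `|1 - 2 * a| ^+ n).
Proof.
have k0 : 0 <= kappa := sqrtr_ge0 _.
have c0 : 0 < c by rewrite invr_gt0 sqrtr_gt0 mulr_gt0.
have kk : kappa ^+ 2 = 2 / pi by rewrite sqr_sqrtr // divr_ge0 ?pi_ge0.
have cp : 0 <= c / pi by rewrite divr_ge0 ?pi_ge0 // ltW.
have [C1 C10 H1] := parity_gap_rate R d1.
have [C2 C20 H2] := parity_gap_rate R d2.
pose K2 := c * (C1 * a^-1) + c * kappa * (C2 * (1 - a)^-1).
have K20 : 0 <= K2.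
  by rewrite addr_ge0 ?mulr_ge0 ?invr_ge0 // ltW.
have c40 : 0 <= c ^+ 4 by rewrite exprn_ge0 // ltW.
exists (1 + c ^+ 4 + K2 + c / pi) => [|n].
  by apply: addr_ge0 => //; apply: addr_ge0 => //; apply: addr_ge0.
pose p d N : R := (~~ odd (N + d))%:R.
(* When [n + d1 + d2] is even, the two parity conditions coincide and hold with probability close to
   1/2, which turns [c * kappa ^+ 2 = 2 * c / pi] into [c / pi]; otherwise they exclude each
   other. *)
have Ep : binE a n (fun N => c * kappa ^+ 2 * (p d1 N * p d2 (n - N)%N)) =
    c / pi * p 0%N (n + d1 + d2)%N +
    c / pi * p 0%N (n + d1 + d2)%N * ((-1) ^+ d1 * (1 - 2 * a) ^+ n).
  rewrite (@binE_ext _ _ _ _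
    (fun N => c * (2 / pi) * p 0%N (n + d1 + d2)%N * p d1 N)).
    rewrite binEZ binE_parity; have := pi_gt0 R => /lt0r_neq0.
    by move: pi c => P C P0; field.
  move=> N Nn; rewrite kk -[RHS]mulrA; congr (_ * _).
  have -> : (n + d1 + d2 = (N + d1) + (n - N + d2))%N.
    by rewrite addnACA subnKC // addnA.
  rewrite /p addn0 (oddD (N + d1)); move: (odd _) (odd _) => [] [] /=;
    by rewrite ?mulr1n ?mulr0n ?mulr0 ?mul0r ?mulr1.
have E : llt_scale R n * walk2 n d1 d2 - c / pi * p 0%N (n + d1 + d2)%N =
  binE a n (fun N => walk_scaled R d1 N * walk_scaled R d2 (n - N) * llt_ratio R n N
    + - 1 * (c * kappa ^+ 2 * (p d1 N * p d2 (n - N)%N))) +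
    c / pi * p 0%N (n + d1 + d2)%N * ((-1) ^+ d1 * (1 - 2 * a) ^+ n).
  by rewrite binED -walk2_scaled binEZ Ep; ring.
have -> : (~~ odd (n + d1 + d2))%:R = p 0%N (n + d1 + d2)%N by rewrite /p addn0.
rewrite E {E}.
apply: le_trans (ler_normD _ _) _.
have le3 : `|c / pi * p 0%N (n + d1 + d2)%N * ((-1) ^+ d1 * (1 - 2 * a) ^+ n)| <=
    c / pi * `|1 - 2 * a| ^+ n.
  rewrite normrM [X in _ * X]normrM normrX normrN1 expr1n mul1r normrX.
  apply: ler_wpM2r; first by rewrite exprn_ge0.
  rewrite normrM (ger0_norm cp) ger0_norm ?ler0n // ler_piMr //.
  by rewrite /p; case: odd.
have le1 : `|binE a n (fun N =>
    walk_scaled R d1 N * walk_scaled R d2 (n - N) * llt_ratio R n N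
    + - 1 * (c * kappa ^+ 2 * (p d1 N * p d2 (n - N)%N)))| <=
    (1 + c ^+ 4) * (Num.sqrt n.+2%:R)^-1 + K2 * n.+1%:R^-1.
  apply: le_trans (ler_norm_binE a0 a1 _ _) _.
  apply: (@le_trans _ _ (binE a n (fun N => `|llt_ratio R n N - c| +
      (c * C1 * N.+1%:R^-1 + c * kappa * C2 * (n - N).+1%:R^-1)))).
    apply: ler_binE => // N _.
    have := H1 N; have := H2 (n - N)%N; rewrite /parity_gap -/(p d1 N) -/(p d2 (n - N)%N).
    have := walk_scaled_ge0 R d1 N; have := walk_scaled_le1 R d1 N.
    have := walk_scaled_ge0 R d2 (n - N); have := walk_scaled_le1 R d2 (n - N).
    have : 0 <= p d1 N <= 1 by rewrite /p; case: odd; rewrite ?ler01 ?lexx.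
    move: (walk_scaled _ _ _) (walk_scaled _ _ _) => v u.
    move: (p _ _) (p _ _) (llt_ratio _ _ _) => r q X /andP[q0 q1] u1 u0 v1 v0 h2 h1.
    (* Telescoping: [X] is replaced by [c], then [v] by [kappa * q], then [u] by [kappa * r]. The
       accompanying factors [v * u], [u] and [q] lie in [0, 1]. *)
    have -> : v * u * X + - 1 * (c * kappa ^+ 2 * (q * r)) =
      v * u * (X - c) + (c * ((v - kappa * q) * u) + c * kappa * ((u - kappa * r) * q)).
      by ring.
    apply: le_trans (ler_normD _ _) _; apply: lerD.
      rewrite normrM ger0_norm ?mulr_ge0 // ler_piMl // mulr_ile1 //.
    have ck0 : 0 <= c * kappa by rewrite mulr_ge0 // ltW.
    apply: le_trans (ler_normD _ _) _; apply: lerD.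
      rewrite normrM (gtr0_norm c0) -mulrA; apply: ler_wpM2l; first exact: ltW.
      by rewrite normrM (ger0_norm u0) (le_trans _ h1) // ler_piMr.
    rewrite normrM (ger0_norm ck0) -mulrA; apply: ler_wpM2l => //.
    by rewrite normrM (ger0_norm q0) (le_trans _ h2) // ler_piMr.
  rewrite !binED !binEZ lerD ?binE_ratio_dist_le //.
  rewrite (binE_rev a n (fun N => N.+1%:R^-1)) [leRHS]mulrDl lerD //.
    rewrite -!mulrA; apply: ler_wpM2l; first exact: ltW.
    apply: ler_wpM2l => //; rewrite -invfM mulrC; exact: binE_inv_le.
  rewrite -!mulrA; apply: ler_wpM2l; first exact: ltW.
  apply: ler_wpM2l => //; apply: ler_wpM2l => //; rewrite -invfM mulrC.
  by apply: binE_inv_le => //; rewrite ltrBlDr ltrDl.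
apply: le_trans (lerD le1 le3) _.
have : 0 <= (Num.sqrt n.+2%:R)^-1 :> R by rewrite invr_ge0 sqrtr_ge0.
have : 0 <= n.+1%:R^-1 :> R by rewrite invr_ge0.
have : 0 <= `|1 - 2 * a| ^+ n by rewrite exprn_ge0.
move: K20 c40 cp.
move: (c ^+ 4) (c / pi) (K2) (Num.sqrt n.+2%:R)^-1 n.+1%:R^-1 (`|1 - 2 * a| ^+ n)
  => x y z u v w z0 x0 y0 w0 v0 u0.
have := mulr_ge0 x0 v0; have := mulr_ge0 x0 w0; have := mulr_ge0 y0 u0.
have := mulr_ge0 y0 v0; have := mulr_ge0 z0 u0; have := mulr_ge0 z0 w0.
by rewrite !mulrDl !mulrDr; lra.
Qed.

Local Open Scope classical_set_scope.

Lemma sqrt_inv_cvg0 : (fun n => (Num.sqrt n.+2%:R)^-1 : R) @ \oo --> 0.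
Proof.
apply/cvgr0Pnorm_lt => e e0; near=> n.
rewrite ger0_norm ?invr_ge0 ?sqrtr_ge0 // invf_plt ?posrE ?sqrtr_gt0 //.
rewrite -(@ltr_pXn2r _ 2) ?nnegrE ?invr_ge0 ?sqrtr_ge0 ?(ltW e0) // sqr_sqrtr //.
apply: (@lt_trans _ _ n%:R); last by rewrite ltr_nat.
near: n; exact: nbhs_infty_gtr.
Unshelve. all: by end_near. Qed.

Lemma walk2_cvg d1 d2 : (fun n => llt_scale R n * walk2 n d1 d2 -
    c / pi * (~~ odd (n + d1 + d2))%:R) @ \oo --> 0.
Proof.
have [K K0 H] := walk2_error d1 d2.
have h : (fun n => K * ((Num.sqrt n.+2%:R)^-1 + n.+1%:R^-1 + `|1 - 2 * a| ^+ n))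
    @ \oo --> K * (0 + 0 + 0).
  apply: cvgMr; apply: cvgD; first apply: cvgD.
  - exact: sqrt_inv_cvg0.
  - exact: cvg_harmonic.
  by apply: cvg_expr; rewrite normr_id norm_one_subM2_lt1.
rewrite !addr0 mulr0 in h; apply/norm_cvg0P; move: h.
apply: squeeze_cvgr; last exact: cvg_cst.
by apply: nearW => n; rewrite normr_ge0 H.
Qed.

End LocalLimitTheorem.

(** * Dominated convergence with geometric weights *)

Section Tannery.
Variable R : realType.
Local Open Scope classical_set_scope.

Lemma sum_geometric_lt1 (z : R) m : z != 1 ->
  \sum_(i < m) z ^+ i = (1 - z ^+ m) / (1 - z).
Proof.
move=> z1; have z1' : 1 - z != 0 by rewrite subr_eq0 eq_sym.
apply: (mulIf z1'); rewrite mulfVK //.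
by rewrite -[RHS]opprB subrX1 -mulNr opprB mulrC.
Qed.

Lemma geometric_sum_bound (z C : R) (u : nat -> R) k m : 0 <= z < 1 -> (k <= m)%N ->
  (forall i, `|u i| <= C) ->
  `|\sum_(k <= i < m) z ^+ i * u i| <= C * z ^+ k / (1 - z).
Proof.
move=> /andP[z0 z1] km uC.
have C0 : 0 <= C by exact: le_trans (normr_ge0 _) (uC 0%N).
have z1' : 0 < 1 - z by rewrite subr_gt0.
apply: le_trans (ler_norm_sum _ _ _) _.
apply: (@le_trans _ _ (\sum_(k <= i < m) C * z ^+ k * z ^+ (i - k))).
  rewrite big_seq [leRHS]big_seq; apply: ler_sum => i.
  rewrite mem_index_iota => /andP[ki _].
  rewrite -mulrA -exprD subnKC // normrM ger0_norm ?exprn_ge0 // mulrC.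
  by rewrite ler_wpM2r ?exprn_ge0.
rewrite -mulr_sumr ler_wpM2l ?mulr_ge0 ?exprn_ge0 //.
rewrite -{1}[k]add0n big_addn big_mkord.
under eq_bigr do rewrite addnK.
rewrite sum_geometric_lt1 ?lt_eqF // -[leRHS]mul1r ler_wpM2r ?invr_ge0 ?(ltW z1') //.
by rewrite lerBlDr lerDl exprn_ge0.
Qed.

(** The part of the sum beyond [k] is of order [z ^+ k] uniformly in [n], and the finite part below
    [k] converges term by term. *)
Lemma geometric_tannery (z C l : R) (v : nat -> nat -> R) (m : nat -> nat) :
  0 <= z < 1 -> (forall n i, `|v n i| <= C) ->
  (forall i, v n i @[n --> \oo] --> l) ->
  (forall k, \forall n \near \oo, (k <= m n)%N) ->
  \sum_(i < m n) z ^+ i * v n i @[n --> \oo] --> l / (1 - z).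
Proof.
move=> z01 vC vl mK; have /andP[z0 z1] := z01.
have z1' : 0 < 1 - z by rewrite subr_gt0.
have C0 : 0 <= C by exact: le_trans (normr_ge0 _) (vC 0%N 0%N).
apply/cvgrPdist_lt => e e0.
have zk : (fun k => (C + `|l|) * z ^+ k / (1 - z)) @ \oo --> (C + `|l|) * 0 / (1 - z).
  by apply: cvgMl; apply: cvgMr; apply: cvg_expr; rewrite ger0_norm.
have e2 : 0 < e / 2 by rewrite divr_gt0.
rewrite mulr0 mul0r in zk.
have [k _ /(_ k (leqnn _))] := @cvgr0_norm_lt _ _ _ _ _ _ zk _ e2.
move=> hk.
have hs j : \sum_(i < j) z ^+ i * v n i @[n --> \oo] --> \sum_(i < j) z ^+ i * l.
  elim: j => [|j IH].
    rewrite big_ord0; under eq_fun do rewrite big_ord0; exact: cvg_cst.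
  rewrite big_ord_recr; under eq_fun do rewrite big_ord_recr.
  by apply: cvgD => //; exact: cvgMr.
near=> n.
have km : (k <= m n)%N by near: n.
have -> : l / (1 - z) - \sum_(i < m n) z ^+ i * v n i =
    (\sum_(i < k) z ^+ i * l - \sum_(i < k) z ^+ i * v n i) +
    (l * z ^+ k / (1 - z) - \sum_(k <= i < m n) z ^+ i * v n i).
  rewrite -mulr_suml sum_geometric_lt1 ?lt_eqF //.
  rewrite -(big_mkord xpredT (fun i => z ^+ i * v n i)).
  rewrite -(big_mkord xpredT (fun i => z ^+ i * v n i)).
  rewrite (big_cat_nat (n := k)) //=.
  move: (bigop _ _ _) (bigop _ _ _) => x y; field.
  by rewrite gt_eqF.
rewrite [e]splitr; apply: le_lt_trans (ler_normD _ _) _; apply: ltrD.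
  by near: n; exact: cvgr_dist_lt (hs k) _ e2.
apply: le_lt_trans hk; apply: le_trans (ler_normB _ _) _.
have T0 : 0 <= z ^+ k / (1 - z) by rewrite divr_ge0 ?exprn_ge0 // ltW.
rewrite [leRHS]ger0_norm; last by rewrite -mulrA mulr_ge0 // addr_ge0.
have -> : (C + `|l|) * z ^+ k / (1 - z) =
    `|l| * (z ^+ k / (1 - z)) + C * z ^+ k / (1 - z) by ring.
apply: lerD; last exact: geometric_sum_bound.
by rewrite -mulrA normrM (ger0_norm T0).
Unshelve. all: by end_near. Qed.

End Tannery.

(** * The Mallows law on three candidates *)

Section ThreeCandidates.

Lemma cand2E : cand2 = lift ord0 ord0.
Proof. by apply/val_inj; rewrite /= inordK. Qed.

Lemma cand3E : cand3 = lift ord0 (lift ord0 ord0).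
Proof. exact/val_inj. Qed.

(* The six rankings are listed by the positions they give to the candidates. *)
Lemma sum_ranking (V : nmodType) (G : 'I_3 -> 'I_3 -> 'I_3 -> V) :
  \sum_(r : ranking) G (r cand1) (r cand2) (r cand3) =
  G cand1 cand2 cand3 + G cand2 cand1 cand3 + G cand1 cand3 cand2 +
  G cand3 cand1 cand2 + G cand2 cand3 cand1 + G cand3 cand2 cand1.
Proof.
have n12 : (cand1 == cand2) = false by rewrite -val_eqE /= inordK.
have n13 : (cand1 == cand3) = false by [].
have n23 : (cand2 == cand3) = false by rewrite -val_eqE /= inordK.
have nE := (n12, n13, n23, eq_sym cand2 cand1, eq_sym cand3 cand1, eq_sym cand3 cand2).
pose t12 : ranking := tperm cand1 cand2; pose t23 : ranking := tperm cand2 cand3.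
pose t13 : ranking := tperm cand1 cand3.
pose s : seq ranking := [:: 1%g; t12; t23; (t12 * t23)%g; (t23 * t12)%g; t13].
have E12 : (t12 cand1 = cand2) * (t12 cand2 = cand1) * (t12 cand3 = cand3).
  by rewrite /t12 tpermL tpermR tpermD ?nE.
have E23 : (t23 cand1 = cand1) * (t23 cand2 = cand3) * (t23 cand3 = cand2).
  by rewrite /t23 tpermL tpermR tpermD ?nE.
have E13 : (t13 cand1 = cand3) * (t13 cand2 = cand2) * (t13 cand3 = cand1).
  by rewrite /t13 tpermL tpermR tpermD ?nE.
pose code (r : ranking) := (r cand1, r cand2).
have us : uniq s.
  apply: (@map_uniq _ _ code); rewrite /= /code !perm1 !permM !(E12, E23, E13).
  by rewrite !inE !xpair_eqE ?eqxx !nE ?eqxx.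
have ps : perm_eq (index_enum ranking) s.
  rewrite perm_sym uniq_perm ?index_enum_uniq //.
  have sub : {subset s <= index_enum ranking} by move=> r _; rewrite mem_index_enum.
  have le : (size (index_enum ranking) <= size s)%N.
    by rewrite -sum1_size (sum1_card predT) card_Sn.
  exact: (uniq_min_size us sub le).2.
rewrite (perm_big _ ps) /= !big_cons big_nil addr0.
by rewrite !perm1 !permM !(E12, E23, E13) !addrA.
Qed.

Lemma cand_val : (cand1 = 0%N :> nat) * (cand2 = 1%N :> nat) * (cand3 = 2%N :> nat).
Proof. by rewrite /= inordK. Qed.

Definition inversions (x y z : 'I_3) : nat := ((y < x) + (z < x) + (z < y))%N.

Lemma kendall_ref (r : ranking) :
  kendall r ref_ranking = inversions (r cand1) (r cand2) (r cand3).
Proof.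
rewrite /kendall cardsE -sum1_card big_mkcond /=.
pose F (x y : 'I_3) : nat := ((x < y) && (above r x y != above ref_ranking x y))%N.
rewrite (eq_bigr (fun p => F p.1 p.2)); last first.
  by move=> p _; rewrite unfold_in /F; case: (_ && _).
rewrite -(pair_bigA _ (fun x y => F x y)) /=.
rewrite !big_ord_recl !big_ord0 -!cand2E -!cand3E /= -/cand1.
rewrite /F /above /ref_ranking !perm1 !cand_val /= !addn0 !add0n.
have inj x y : (r x == r y :> nat) = (x == y) by rewrite val_eqE (inj_eq perm_inj).
rewrite /inversions !eqb_id.
have n12 : (cand1 == cand2) = false by rewrite -val_eqE /= ?inordK.
have n13 : (cand1 == cand3) = false by rewrite -val_eqE /= ?inordK.
have n23 : (cand2 == cand3) = false by rewrite -val_eqE /= ?inordK.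
have := inj cand1 cand2; have := inj cand1 cand3; have := inj cand2 cand3.
rewrite n12 n13 n23.
by move: (r cand1 : nat) (r cand2 : nat) (r cand3 : nat) => x y z; lia.
Qed.

Variables (R : realType) (rho : R).
Local Notation e := (expR (- rho)).

(** The generating function of inversions over the six rankings, [(1 + e) * (1 + e + e ^+ 2)]. *)
Definition mallows_norm : R := 1 + 2 * e + 2 * e ^+ 2 + e ^+ 3.

Lemma mallows_norm_gt0 : 0 < mallows_norm.
Proof.
by rewrite /mallows_norm; have := expR_gt0 (- rho); move: e => x x0; nra.
Qed.

Lemma mallowsE (r : ranking) : mallows rho r =
  e ^+ inversions (r cand1) (r cand2) (r cand3) / mallows_norm.
Proof.
rewrite /mallows expRM_natr kendall_ref; congr (_ / _).
rewrite (eq_bigr (fun s : ranking =>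
  e ^+ inversions (s cand1) (s cand2) (s cand3))); last first.
  by move=> s _; rewrite expRM_natr kendall_ref.
rewrite (sum_ranking (fun x y z => e ^+ inversions x y z)).
by rewrite /inversions !cand_val /= /mallows_norm; ring.
Qed.

(** The morphism [phi] allows two uses: the identity for values of [Ppoly], and the embedding of
    constants for generating polynomials in two variables. *)
Lemma sum_mallows (A : comPzRingType) (phi : {rmorphism R -> A})
    (h : bool -> bool -> A) :
  \sum_(r : ranking) phi (mallows rho r) * h (above r cand1 cand3) (above r cand2 cand3) =
  phi ((1 + e) / mallows_norm) * h true true +
  phi (e / mallows_norm) * h true false +
  phi (e ^+ 2 / mallows_norm) * h false true +
  phi ((e ^+ 2 + e ^+ 3) / mallows_norm) * h false false.
Proof.
under eq_bigr do rewrite mallowsE.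
rewrite (sum_ranking (fun x y z =>
  phi (e ^+ inversions x y z / mallows_norm) * h (x < z)%N (y < z)%N)).
rewrite /inversions !cand_val /= !mulrDl !rmorphD /= expr1 expr0.
move: (phi _) (phi _) (phi _) (phi _) => x y z t; ring.
Qed.

Lemma PpolyE (x1 x2 : R) : Ppoly rho x1 x2 =
  ((1 + e) * (x1 * x2) + e * x1 + e ^+ 2 * x2 + (e ^+ 2 + e ^+ 3)) / mallows_norm.
Proof.
pose f (j : 'I_3) : R := if j == cand1 then x1 else x2.
have n12 : (cand2 == cand1) = false by rewrite -val_eqE /= ?inordK.
transitivity (\sum_(r : ranking) mallows rho r * \prod_(j in above3 r) f j).
  rewrite (partition_big above3 (fun X => X \subset [set cand1; cand2])) /=.
    apply: eq_bigr => X _; rewrite mulr_suml; apply: eq_bigr => r /eqP <- //.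
  move=> r _; apply/fintype.subsetP => c; rewrite !inE /above.
  case: (unliftP ord0 c) => [y ->|->]; last by rewrite eqxx.
  case: (unliftP ord0 y) => [z ->|->]; last by rewrite -cand2E eqxx orbT.
  by rewrite (ord1 z) -cand3E ltnn.
pose h b1 b2 : R := (if b1 then x1 else 1) * (if b2 then x2 else 1).
transitivity (\sum_(r : ranking) idfun (mallows rho r) *
    h (above r cand1 cand3) (above r cand2 cand3)).
  apply: eq_bigr => r _; congr (_ * _); rewrite big_mkcond /=.
  rewrite !big_ord_recl big_ord0 -!cand2E -!cand3E -/cand1 !inE /above ltnn.
  by rewrite mulr1 mulr1 /f eqxx n12.
rewrite sum_mallows /h /=; ring.
Qed.

End ThreeCandidates.

(** * The tilted law as a pair of random walks *)

Definition dist (p q : nat) : nat := ((p - q) + (q - p))%N.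

Section Coefficients.
Variable R : realType.

Lemma sum_pick (m k : nat) (F : nat -> R) :
  \sum_(l < m) F l * (l == k :> nat)%:R = if (k < m)%N then F k else 0.
Proof.
case: ifP => km.
  rewrite (bigD1 (Ordinal km)) //= eqxx mulr1 big1 ?addr0 // => i /negbTE.
  by rewrite -val_eqE /= => ->; rewrite mulr0.
rewrite big1 // => i _; case: eqP => [ik|]; last by rewrite mulr0.
by have := ltn_ord i; rewrite ik km.
Qed.

(** With [l] steps up the walk stands at [2 * l - N], so the condition places it at [q - p]; the
    symmetry of binomial coefficients leaves only the distance. *)
Lemma walk_sum N p q :
  \sum_(l < N.+1) 'C(N, l)%:R / 2 ^+ N * (l.*2 + p == N + q)%N%:R =
  walk R N (dist p q).
Proof.
have [od|ev] := boolP (odd (N + dist p q)).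
  rewrite walk_odd // big1 // => l _; case: eqP => [h|]; last by rewrite mulr0.
  by move: od; rewrite /dist; lia.
have [pq|qp] := leqP p q.
  under eq_bigr => l _.
    have -> : (l.*2 + p == N + q)%N = (l == (N + dist p q)./2 :> nat).
      by move: ev; rewrite /dist; lia.
    over.
  rewrite (sum_pick _ _ (fun l => 'C(N, l)%:R / 2 ^+ N)) /walk (negbTE ev) ltnS.
  by case: leqP => // h; rewrite bin_small // mul0r.
have [dN|Nd] := leqP (dist p q) N; last first.
  rewrite /walk (negbTE ev) bin_small ?mul0r; last by lia.
  rewrite big1 // => l _; case: eqP => [h|]; last by rewrite mulr0.
  by move: Nd; rewrite /dist; lia.
under eq_bigr => l _.
  have -> : (l.*2 + p == N + q)%N = (l == (N - (N + dist p q)./2)%N :> nat).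
    by move: ev dN; rewrite /dist; lia.
  over.
rewrite (sum_pick _ _ (fun l => 'C(N, l)%:R / 2 ^+ N)) /walk (negbTE ev).
rewrite ltnS leq_subr bin_sub //; lia.
Qed.

(* [x] and [y] count the voters ranking candidates 1 and 2 above 3. *)
Local Notation y := ('X : {poly {poly R}}).
Local Notation x := ('X%:P : {poly {poly R}}).
Local Notation K c := (c%:P%:P : {poly {poly R}}).

Lemma coef_monomial (i j k1 k2 : nat) :
  (x ^+ i * y ^+ j)`_k2`_k1 = ((i == k1) && (j == k2))%:R.
Proof.
rewrite -rmorphXn coefCM coefXn eq_sym.
case: eqP => _; last by rewrite mulr0 coef0 andbF.
by rewrite mulr1 coefXn eq_sym andbT.
Qed.

(** A choice in a factor [1 + x * y] affects only the sum of the exponents, a choice in [x + y] only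
    their difference. In these rotated coordinates the two walks separate. *)
Lemma coef_walk_product (N M k1 k2 : nat) :
  ((x + y) ^+ M * (1 + x * y) ^+ N)`_k2`_k1 =
  2 ^+ N * 2 ^+ M * (walk R N (dist (k1 + k2) (N + M)) * walk R M (dist k1 k2)).
Proof.
have -> : dist (k1 + k2) (N + M) = dist (N + M) (k1 + k2) by rewrite /dist addnC.
have -> : dist k1 k2 = dist k2 k1 by rewrite /dist addnC.
rewrite [x + y]addrC (exprDn y x) (exprDn 1 (x * y)) mulrC -!walk_sum.
rewrite [in LHS]mulr_suml [in RHS]mulr_suml mulr_sumr !coef_sum.
apply: eq_bigr => -[l /= lN] _; rewrite 3!mulr_sumr !coef_sum.
apply: eq_bigr => -[j /= jM] _.
have -> : 1 ^+ (N - l) * (x * y) ^+ l *+ 'C(N, l) *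
    (y ^+ (M - j) * x ^+ j *+ 'C(M, j)) =
    (x ^+ (l + j) * y ^+ (l + (M - j))) *+ ('C(N, l) * 'C(M, j)).
  rewrite mulrnAl mulrnAr -mulrnA mulnC; congr (_ *+ _).
  by rewrite expr1n mul1r exprMn !exprD; ring.
rewrite 2!coefMn coef_monomial -[_ *+ (_ * _)%N]mulr_natl natrM.
(* The sum and the difference of the two equations, written without subtraction to fit
   [walk_sum]. *)
have -> : ((l + j == k1) && (l + (M - j) == k2))%N =
    ((l.*2 + (N + M) == N + (k1 + k2)) && (j.*2 + k2 == M + k1))%N.
  by rewrite !ltnS in lN jM; lia.
rewrite -mulnb natrM.
have : 2 ^+ N != 0 :> R by rewrite expf_neq0.
have : 2 ^+ M != 0 :> R by rewrite expf_neq0.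
move: (2 ^+ N) (2 ^+ M) => u v v0 u0; field.
by rewrite u0 v0.
Qed.

Lemma coef_two_walks (a : R) (n k1 k2 : nat) :
  ((K ((1 - a) / 2) * (x + y) + K (a / 2) * (1 + x * y)) ^+ n)`_k2`_k1 =
  walk2 a n (dist (k1 + k2) n) (dist k1 k2).
Proof.
rewrite exprDn /walk2 /binE !coef_sum; apply: eq_bigr => -[N /= Nn] _.
rewrite ltnS in Nn.
have E (u v : R) : (K u * (x + y)) ^+ (n - N) * (K v * (1 + x * y)) ^+ N =
   K (u ^+ (n - N) * v ^+ N) * ((x + y) ^+ (n - N) * (1 + x * y) ^+ N).
  by rewrite !exprMn mulrACA -!rmorphXn -!rmorphM.
rewrite E 2!coefMn 2!coefCM coef_walk_product subnKC // -[_ *+ 'C(_, _)]mulr_natl !exprMn !exprVn.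
have : 2 ^+ N != 0 :> R by rewrite expf_neq0.
have : 2 ^+ (n - N) != 0 :> R by rewrite expf_neq0.
move: (2 ^+ N) (2 ^+ (n - N)) => u v v0 u0; field.
by rewrite u0 v0.
Qed.

End Coefficients.

(** * Exponential tilting and an exact formula for the winning probability *)

Section CondorcetWinner.
Variables (R : realType) (rho : R).
Local Notation s := (expR (- (rho / 2))).
Local Notation e := (expR (- rho)).
Local Notation z1 := (zeta1 rho).
Local Notation z2 := (zeta2 rho).
Local Notation P := (Ppoly rho z1 z2).

(** The tilted probability that a voter ranks both or neither of candidates 1 and 2 above 3. *)
Definition diag_weight : R := (1 + s ^+ 2) / (1 + s + s ^+ 2).
Local Notation a := diag_weight.

Lemma expR_half_gt0 : 0 < s. Proof. exact: expR_gt0. Qed.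
Let s0 := expR_half_gt0.

Lemma expR_rho : e = s ^+ 2.
Proof. by rewrite -expRM_natr; congr expR; field. Qed.

Lemma expR_2rho : expR (- (2 * rho)) = s ^+ 4.
Proof. by rewrite -expRM_natr; congr expR; field. Qed.

Lemma zeta1E : z1 = s ^+ 3.
Proof. by rewrite /zeta1 /tau1 -expRM_natr; congr expR; field. Qed.

Lemma zeta2E : z2 = s. Proof. by []. Qed.

Lemma diag_weight_denom_gt0 : 0 < 1 + s + s ^+ 2.
Proof. by rewrite !addr_gt0 ?exprn_gt0. Qed.

Lemma diag_weight_gt0 : 0 < a.
Proof. by rewrite divr_gt0 ?diag_weight_denom_gt0 // addr_gt0 ?exprn_gt0. Qed.

Lemma diag_weight_lt1 : a < 1.
Proof. by rewrite ltr_pdivrMr ?diag_weight_denom_gt0 // mul1r; have := s0; lra. Qed.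

Lemma Ppoly_zeta : P = 2 * s ^+ 4 * (1 + s + s ^+ 2) / mallows_norm rho.
Proof. by rewrite PpolyE zeta1E zeta2E expR_rho; congr (_ / _); ring. Qed.

Lemma mallows_norm_half : mallows_norm rho = (1 + s ^+ 2) * (1 + s ^+ 2 + s ^+ 4).
Proof. by rewrite /mallows_norm expR_rho; ring. Qed.

Lemma Ppoly_zeta_gt0 : 0 < P.
Proof.
rewrite Ppoly_zeta divr_gt0 ?mallows_norm_gt0 //.
by rewrite !mulr_gt0 ?diag_weight_denom_gt0 ?exprn_gt0.
Qed.

Definition tilted (r : ranking) : R := mallows rho r *
  (z1 ^+ above r cand1 cand3 * z2 ^+ above r cand2 cand3 / P).

Lemma sum_tilted_monomials :
  \sum_(r : ranking) (tilted r)%:P%:P *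
     ('X%:P ^+ above r cand1 cand3 * 'X ^+ above r cand2 cand3) =
  ((1 - a) / 2)%:P%:P * ('X%:P + 'X) + (a / 2)%:P%:P * (1 + 'X%:P * 'X)
    :> {poly {poly R}}.
Proof.
pose phi : {rmorphism R -> {poly {poly R}}} := polyC \o polyC.
pose h (b1 b2 : bool) : {poly {poly R}} :=
  phi (z1 ^+ b1 * z2 ^+ b2 / P) * ('X%:P ^+ b1 * 'X ^+ b2).
transitivity (\sum_(r : ranking) phi (mallows rho r) *
    h (above r cand1 cand3) (above r cand2 cand3)).
  by apply: eq_bigr => r _; rewrite /h [in RHS]mulrA -(rmorphM phi).
rewrite sum_mallows /h !mulrA -!(rmorphM phi) /= !expr0 !expr1 !mulr1.
have s0' := s0; have d0 := diag_weight_denom_gt0.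
have m0 := mallows_norm_gt0 rho; have p0 := Ppoly_zeta_gt0.
(* The choice of [zeta] makes the weights equal in pairs: up to a common factor, [s ^+ 4 + s ^+ 6]
   for both or neither above 3, and [s ^+ 5] for exactly one. Each count is thus centred at
   [n / 2]. *)
have A1 : (1 + e) / mallows_norm rho * (z1 * z2 / P) = a / 2.
  rewrite Ppoly_zeta /diag_weight zeta1E zeta2E expR_rho.
  by field; rewrite !gt_eqF.
have A2 : e / mallows_norm rho * (z1 / P) = (1 - a) / 2.
  rewrite Ppoly_zeta /diag_weight zeta1E expR_rho.
  by field; rewrite !gt_eqF.
have A3 : e ^+ 2 / mallows_norm rho * (1 * z2 / P) = (1 - a) / 2.
  rewrite Ppoly_zeta /diag_weight zeta2E expR_rho.
  by field; rewrite !gt_eqF.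
have A4 : (e ^+ 2 + e ^+ 3) / mallows_norm rho * (1 / P) = a / 2.
  rewrite Ppoly_zeta /diag_weight expR_rho.
  by field; rewrite !gt_eqF.
rewrite A1 A2 A3 A4; ring.
Qed.

Definition above_count (j : 'I_3) n (v : profile n) : nat :=
  \sum_(i < n) above (v i) j cand3.

(** By distributivity, the [n]-th power of the generating polynomial of one voter is the sum over
    profiles; the coefficient at [k1], [k2] is then read off on both sides. *)
Lemma sum_tilted_profile n k1 k2 :
  \sum_(v : profile n) (\prod_(i < n) tilted (v i)) *
     ((above_count cand1 v == k1) && (above_count cand2 v == k2))%:R =
  walk2 a n (dist (k1 + k2) n) (dist k1 k2).
Proof.
rewrite -coef_two_walks -sum_tilted_monomials -[in RHS](card_ord n) -prodr_const.
rewrite bigA_distr_bigA /= !coef_sum; apply: eq_bigr => v _.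
have -> : \prod_(i < n) ((tilted (v i))%:P%:P *
      ('X%:P ^+ above (v i) cand1 cand3 * 'X ^+ above (v i) cand2 cand3)) =
    (\prod_(i < n) tilted (v i))%:P%:P *
      ('X%:P ^+ above_count cand1 v * 'X ^+ above_count cand2 v) :> {poly {poly R}}.
  by rewrite !rmorph_prod !big_split /= !prodrXr.
by rewrite 2!coefCM coef_monomial.
Qed.

(** Each voter ranks exactly one of [j] and 3 above the other, and [n < 2 * (n - k)] means
    [k < uphalf n] for either parity of [n]. *)
Lemma cw3E n (v : profile n) : cw3 v =
  (above_count cand1 v < uphalf n)%N && (above_count cand2 v < uphalf n)%N.
Proof.
have n13 : (cand1 == cand3) = false by [].
have n23 : (cand2 == cand3) = false by rewrite -val_eqE /= inordK.
have H j : (j == cand3) = false ->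
    (n < 2 * #|[set i : 'I_n | above (v i) cand3 j]|)%N = (above_count j v < uphalf n)%N.
  move=> j3; suff E : (#|[set i : 'I_n | above (v i) cand3 j]| + above_count j v = n)%N.
    by move: E; move: #|_| (above_count _ _) => p q; lia.
  rewrite -sum1dep_card big_mkcond -big_split /= -[RHS]card_ord -sum1_card.
  apply: eq_bigr => i _; rewrite /above.
  have : (v i j == v i cand3 :> nat) = false by rewrite val_eqE (inj_eq perm_inj).
    by case: ltngtP.
apply/forallP/andP => [h|[h1 h2] j].
  by split; [have := h cand1|have := h cand2]; rewrite !inE eqxx ?orbT /= H.
by apply/implyP; rewrite !inE => /orP[] /eqP ->; rewrite H.
Qed.

(** Serves to index a winning count by its deficit [i] below the largest admissible value [m - 1],
    which later produces the weights [z ^+ i]. *)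
Lemma sum_index_below (m k : nat) :
  \sum_(i < m) (k == m - i.+1)%N%:R = (k < m)%N%:R :> R.
Proof.
transitivity (\sum_(i < m) 1 * ((i == (m - k.+1)%N :> nat) && (k < m)%N)%:R : R).
  by apply: eq_bigr => -[i /= im] _; rewrite mul1r; congr (_%:R); lia.
case: leqP => km; first by rewrite big1 // => i _; rewrite andbF mulr0.
under eq_bigr do rewrite andbT.
rewrite (sum_pick _ _ (fun=> 1)); case: ifP => //; lia.
Qed.

(** Undoing the tilt voter by voter costs a factor that depends on the profile only through its two
    counts, so the sum over profiles with given counts is a [walk2]. *)
Lemma prob_cw3E n : prob_cw3 rho n = P ^+ n *
  \sum_(i < uphalf n) \sum_(j < uphalf n)
    z1 ^- (uphalf n - i.+1) * z2 ^- (uphalf n - j.+1) *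
    walk2 a n (dist ((uphalf n - i.+1) + (uphalf n - j.+1)) n)
              (dist (uphalf n - i.+1) (uphalf n - j.+1)).
Proof.
have p0 := Ppoly_zeta_gt0.
have z10 : z1 != 0 by rewrite gt_eqF ?expR_gt0.
have z20 : z2 != 0 by rewrite gt_eqF ?expR_gt0.
have E (r : ranking) : mallows rho r = P * (z1^-1 ^+ above r cand1 cand3 *
    z2^-1 ^+ above r cand2 cand3) * tilted r.
  rewrite /tilted !exprVn.
  have : z1 ^+ above r cand1 cand3 != 0 by rewrite expf_neq0.
  have : z2 ^+ above r cand2 cand3 != 0 by rewrite expf_neq0.
  move: (z1 ^+ _) (z2 ^+ _) (mallows _ _) => u v w v0 u0.
  by field; rewrite u0 v0 gt_eqF.
have Ev (v : profile n) : \prod_(i < n) mallows rho (v i) =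
    P ^+ n * (z1 ^- above_count cand1 v * z2 ^- above_count cand2 v *
    \prod_(i < n) tilted (v i)).
  under eq_bigr do rewrite E.
  rewrite !big_split /= prodr_const card_ord !prodrXr !exprVn; ring.
rewrite /prob_cw3 big_mkcond mulr_sumr /=.
transitivity (\sum_(v : profile n) \sum_(i < uphalf n) \sum_(j < uphalf n)
   P ^+ n * (z1 ^- (uphalf n - i.+1) * z2 ^- (uphalf n - j.+1) *
   ((\prod_(i < n) tilted (v i)) *
     ((above_count cand1 v == uphalf n - i.+1)%N &&
      (above_count cand2 v == uphalf n - j.+1)%N)%:R))).
  apply: eq_bigr => v _; rewrite cw3E Ev.
  set k1 := above_count cand1 v; set k2 := above_count cand2 v.
  set T := \prod_(i < n) _.
  transitivity (P ^+ n * (z1 ^- k1 * z2 ^- k2 * T) *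
     ((k1 < uphalf n)%N%:R * (k2 < uphalf n)%N%:R)).
    by rewrite -natrM mulnb; case: (_ && _); rewrite ?mulr1 ?mulr0.
  rewrite -!sum_index_below mulr_suml mulr_sumr; apply: eq_bigr => i _.
  rewrite mulr_sumr mulr_sumr; apply: eq_bigr => j _.
  case: eqP => [<-|_]; last by rewrite mul0r !mulr0.
  by case: eqP => [<-|_]; rewrite ?mul1r ?mulr0 // !mulr1; ring.
rewrite exchange_big /=; apply: eq_bigr => i _.
rewrite exchange_big mulr_sumr /=; apply: eq_bigr => j _.
rewrite -sum_tilted_profile; rewrite -!mulr_sumr; ring.
Qed.

End CondorcetWinner.

(** * The Hessian *)

Section Hessian.
Variables (R : realType) (rho : R).
Local Notation s := (expR (- (rho / 2))).
Local Notation e := (expR (- rho)).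

Lemma derive1_ln_affine_expR (p q t : R) : 0 < p -> 0 < q ->
  derive1 (fun x => ln (p * expR x + q)) t = p * expR t / (p * expR t + q).
Proof.
move=> p0 q0; have d0 : 0 < p * expR t + q by rewrite addr_gt0 // mulr_gt0 // expR_gt0.
rewrite derive1E.
have D : is_derive t 1 (p *: expR + cst q : R -> R) (p *: expR t + 0).
  exact: is_deriveD.
have := @is_derive1_comp R (@ln R) (p *: expR + cst q : R -> R) t _ _
  (is_derive1_ln d0) D.
move=> /@derive_val ->; rewrite addr0 mulrC; congr (_ * _).
Qed.

(** [Ppoly] is affine in each argument, so each first partial of [Kfun] is a Moebius function of
    either exponential; this one formula yields all the second partials. *)
Lemma derive1_moebius_expR (p q r u t : R) : r * expR t + u != 0 ->
  derive1 (fun x => (p * expR x + q) / (r * expR x + u)) t =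
  (p * u - q * r) * expR t / (r * expR t + u) ^+ 2.
Proof.
move=> d0; rewrite derive1E.
have D (v w : R) : is_derive t 1 (v *: expR + cst w : R -> R) (v *: expR t + 0).
  exact: is_deriveD.
have DV := @is_deriveV _ (r *: expR + cst u : R -> R) t _ 1 d0 (D r u).
have := is_deriveM (D p q) DV.
move=> /@derive_val ->; rewrite /GRing.scale /= !addr0.
rewrite !fctE /GRing.scale /=.
have E (X : R) : r * X + u != 0 -> (p * X + q) * (- (r * X + u) ^- 2 * (r * X)) +
    (r * X + u)^-1 * (p * X) = (p * u - q * r) * X / (r * X + u) ^+ 2.
  by move=> X0; field.
exact: E.
Qed.

Lemma det2 (M : 'M[R]_2) : \det M =
  M ord0 ord0 * M ord_max ord_max - M ord0 ord_max * M ord_max ord0.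
Proof.
have m0 : lift ord0 ord0 = ord_max :> 'I_2 by exact/val_inj.
have m1 : lift ord_max ord0 = ord0 :> 'I_2 by exact/val_inj.
rewrite (expand_det_row _ ord0) !big_ord_recl big_ord0 /cofactor !det_mx11 !mxE /=.
by rewrite m0 m1 /= expr0 expr1; ring.
Qed.

Lemma hessian_entries :
  hessian (Kfun rho) (tau1 rho) (tau2 rho) =
  \matrix_(i < 2, j < 2)
    if i == j then 4^-1 else 4^-1 * ((1 - s + s ^+ 2) / (1 + s + s ^+ 2)).
Proof.
have m0 := mallows_norm_gt0 rho; have e0 : 0 < e := expR_gt0 _.
have s0 : 0 < s := expR_gt0 _.
pose al := (1 + e) / mallows_norm rho; pose be := e / mallows_norm rho.
pose ga := e ^+ 2 / mallows_norm rho; pose de := (e ^+ 2 + e ^+ 3) / mallows_norm rho.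
have al0 : 0 < al by rewrite divr_gt0 // addr_gt0.
have be0 : 0 < be by rewrite divr_gt0.
have ga0 : 0 < ga by rewrite divr_gt0 // exprn_gt0.
have de0 : 0 < de by rewrite divr_gt0 // addr_gt0 ?exprn_gt0.
have ex (t : R) : 0 < expR t := expR_gt0 t.
have pos (p q t : R) : 0 < p -> 0 < q -> 0 < p * expR t + q.
  by move=> p0 q0; rewrite addr_gt0 // mulr_gt0.
have PE x y : Ppoly rho (expR x) (expR y) =
    (al * expR y + be) * expR x + (ga * expR y + de).
  by rewrite PpolyE /al /be /ga /de; ring.
have PE' x y : Ppoly rho (expR x) (expR y) =
    (al * expR x + ga) * expR y + (be * expR x + de).
  by rewrite PpolyE /al /be /ga /de; ring.
have K0 : partial ord0 (Kfun rho) = fun x y =>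
    ((al * expR y + be) * expR x + 0) / ((al * expR y + be) * expR x + (ga * expR y + de)).
  apply/funext => x; apply/funext => y; rewrite /partial eqxx addr0.
  have E : (fun t => Kfun rho t y) =
      (fun t => ln ((al * expR y + be) * expR t + (ga * expR y + de))).
    by apply/funext => t; rewrite /Kfun PE.
  apply: etrans (derive1_ln_affine_expR x (pos _ _ y al0 be0) (pos _ _ y ga0 de0)).
  exact: (congr1 (fun f : R -> R => derive1 f x) E).
have K1 : partial ord_max (Kfun rho) = fun x y =>
    ((al * expR x + ga) * expR y + 0) / ((al * expR x + ga) * expR y + (be * expR x + de)).
  apply/funext => x; apply/funext => y; rewrite /partial /= addr0.
  have E : (fun t => Kfun rho x t) =
      (fun t => ln ((al * expR x + ga) * expR t + (be * expR x + de))).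
    by apply/funext => t; rewrite /Kfun PE'.
  apply: etrans (derive1_ln_affine_expR y (pos _ _ x al0 ga0) (pos _ _ x be0 de0)).
  exact: (congr1 (fun f : R -> R => derive1 f y) E).
have [x tau1E] : exists x, tau1 rho = x by exists (tau1 rho).
have [y tau2E] : exists y, tau2 rho = y by exists (tau2 rho).
have xE : expR x = s ^+ 3 by rewrite -tau1E; exact: zeta1E.
have yE : expR y = s by rewrite -tau2E.
have d0 := diag_weight_denom_gt0 rho.
have [s0' m0'] := (lt0r_neq0 s0, lt0r_neq0 m0).
have d0' := lt0r_neq0 d0.
set T := 1 + s + s ^+ 2 in d0' *; set Z := mallows_norm rho in m0' *.
have A1 : al * expR y + be = s * T / Z.
  by rewrite yE /al /be /T expR_rho; ring.
have A2 : ga * expR y + de = s ^+ 4 * T / Z.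
  by rewrite yE /ga /de /T expR_rho; ring.
have A3 : al * expR x + ga = s ^+ 3 * T / Z.
  by rewrite xE /al /ga /T expR_rho; ring.
have A4 : be * expR x + de = s ^+ 4 * T / Z.
  by rewrite xE /be /de /T expR_rho; ring.
have D1 : (al * expR y + be) * expR x + (ga * expR y + de) = 2 * s ^+ 4 * T / Z.
  by rewrite A1 A2 xE; ring.
have D2 : (al * expR x + ga) * expR y + (be * expR x + de) = 2 * s ^+ 4 * T / Z.
  by rewrite A3 A4 yE; ring.
have alE : al = (1 + s ^+ 2) / Z by rewrite /al expR_rho.
have beE : be = s ^+ 2 / Z by rewrite /be expR_rho.
have gaE : ga = s ^+ 4 / Z by rewrite /ga expR_rho -exprM.
have H00 : partial ord0 (partial ord0 (Kfun rho)) x y = 4^-1.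
  rewrite K0 {1}/partial eqxx derive1_moebius_expR ?gt_eqF ?pos //; [|exact: addr_gt0..].
  rewrite ?D1 ?D2 ?A1 ?A2 ?A3 ?A4 ?xE ?yE ?alE ?beE ?gaE.
  move: (T) (Z) (s) d0' m0' s0' => t z u t0 z0 u0.
  by field; rewrite ?t0 ?z0 ?u0.
have H11 : partial ord_max (partial ord_max (Kfun rho)) x y = 4^-1.
  rewrite K1 {1}/partial /= derive1_moebius_expR ?gt_eqF ?pos //.
  rewrite ?D1 ?D2 ?A1 ?A2 ?A3 ?A4 ?xE ?yE ?alE ?beE ?gaE.
  move: (T) (Z) (s) d0' m0' s0' => t z u t0 z0 u0.
  by field; rewrite ?t0 ?z0 ?u0.
have H01 : partial ord0 (partial ord_max (Kfun rho)) x y =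
    4^-1 * ((1 - s + s ^+ 2) / T).
  rewrite K1 {1}/partial eqxx.
  (* For the mixed partial, the same quotient is regrouped as a Moebius function of the other
     exponential. *)
  have -> : (fun x => ((al * expR x + ga) * expR y + 0) /
      ((al * expR x + ga) * expR y + (be * expR x + de))) =
    (fun x => ((al * expR y) * expR x + ga * expR y) /
      ((al * expR y + be) * expR x + (ga * expR y + de))).
    by apply/funext => t; congr (_ / _); ring.
  rewrite derive1_moebius_expR ?gt_eqF ?pos //.
  rewrite ?D1 ?D2 ?A1 ?A2 ?A3 ?A4 ?xE ?yE ?alE ?beE ?gaE.
  move: (T) (Z) (s) d0' m0' s0' => t z u t0 z0 u0.
  by field; rewrite ?t0 ?z0 ?u0.
have H10 : partial ord_max (partial ord0 (Kfun rho)) x y =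
    4^-1 * ((1 - s + s ^+ 2) / T).
  rewrite K0 {1}/partial /=.
  have -> : (fun y => ((al * expR y + be) * expR x + 0) /
      ((al * expR y + be) * expR x + (ga * expR y + de))) =
    (fun y => ((al * expR x) * expR y + be * expR x) /
      ((al * expR x + ga) * expR y + (be * expR x + de))).
    by apply/funext => t; congr (_ / _); ring.
  rewrite derive1_moebius_expR ?gt_eqF ?pos //.
  rewrite ?D1 ?D2 ?A1 ?A2 ?A3 ?A4 ?xE ?yE ?alE ?beE ?gaE.
  move: (T) (Z) (s) d0' m0' s0' => t z u t0 z0 u0.
  by field; rewrite ?t0 ?z0 ?u0.
apply/matrixP => i j; rewrite !mxE tau1E tau2E.
have o2 (k : 'I_2) : k = ord0 \/ k = ord_max.
  by case: k => -[|[|//]] kk; [left|right]; exact/val_inj.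
have n01 : (ord0 == ord_max :> 'I_2) = false by [].
by case: (o2 i) => ->; case: (o2 j) => ->; rewrite ?eqxx ?n01.
Qed.

(** With [a] the diagonal weight, the off-diagonal entry is [(2 * a - 1) / 4], and
    [1 - (2 * a - 1) ^+ 2 = 4 * a * (1 - a)]. *)
Lemma det_hessian : \det (hessian (Kfun rho) (tau1 rho) (tau2 rho)) =
  4^-1 * (diag_weight rho * (1 - diag_weight rho)).
Proof.
have d0 := diag_weight_denom_gt0 rho.
rewrite hessian_entries det2 !mxE /= /diag_weight.
by field; rewrite gt_eqF.
Qed.

End Hessian.

(** * Asymptotics of the winning probability *)

Section Assembly.
Variable R : realType.
Local Open Scope classical_set_scope.

Lemma equiv_of_ratio (f g u : nat -> R) : u @ \oo --> (1 : R) ->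
  (\forall n \near \oo, f n = u n * g n) -> f ~_\oo g.
Proof.
move=> u1 fE; apply/eqaddoP => eps eps0; near=> n.
have -> : (f - g) n = (u n - 1) * g n.
  rewrite !fctE mulrBl mul1r; congr (_ - _); near: n; exact: fE.
rewrite normrM ler_wpM2r // distrC; near: n.
exact: cvgr_dist_le u1 _ eps0.
Unshelve. all: by end_near. Qed.

(** The scale lies between [n + 1] and [n + 2], so the quotient differs from 1 by at most
    [2 / (n + 1)]. *)
Lemma nat_div_llt_scale_cvg : (fun n => n%:R / llt_scale R n) @ \oo --> (1 : R).
Proof.
have h : (fun n => 2 * (n.+1%:R)^-1 : R) @ \oo --> 2 * (0 : R).
  by apply: cvgMr; exact: cvg_harmonic.
rewrite mulr0 in h.
apply/cvgrPdist_le => eps eps0.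
move/cvgrPdist_le: h => /(_ _ eps0); apply: filterS => n.
rewrite sub0r normrN; apply: le_trans.
have l0 := llt_scale_gt0 R n.
have l2 : llt_scale R n ^+ 2 = (n%:R + 1) * (n%:R + 2).
  by rewrite sqr_sqrtr ?mulr_ge0 // -!natr1; ring.
have n0 : 0 <= n%:R :> R by [].
rewrite [leRHS]ger0_norm ?mulr_ge0 ?invr_ge0 // -[n.+1%:R]natr1.
move: (llt_scale R n) n%:R l0 l2 n0 => l x l0 l2 x0.
have x1 : 0 < x + 1 by rewrite ltr_wpDl.
have lx : x + 1 <= l by rewrite -(@ler_pXn2r _ 2) ?nnegrE ?ltW // l2; nra.
have lx2 : l <= x + 2.
  by rewrite -(@ler_pXn2r _ 2) ?nnegrE ?(ltW l0) ?addr_ge0 // l2; nra.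
have -> : 1 - x / l = (l - x) / l by field; rewrite gt_eqF.
rewrite ger0_norm; last by rewrite divr_ge0 ?(ltW l0) // subr_ge0; lra.
apply: ler_pM; rewrite ?invr_ge0 ?subr_ge0; try lra.
by rewrite lef_pV2 ?posrE.
Qed.

Lemma near_uphalf_ge k : \forall n \near \oo, (k <= uphalf n)%N.
Proof. by exists k.*2 => // n /= kn; lia. Qed.

Section Weighted.
Variables (rho : R).
Hypothesis rho0 : 0 < rho.
Local Notation a := (diag_weight rho).
Local Notation c := (Num.sqrt (a * (1 - a)))^-1.
Local Notation z1 := (zeta1 rho).
Local Notation z2 := (zeta2 rho).
Local Notation P := (Ppoly rho z1 z2).

Definition winning_term (n i j : nat) : R := llt_scale R n *
  walk2 a n (dist ((uphalf n - i.+1) + (uphalf n - j.+1)) n)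
            (dist (uphalf n - i.+1) (uphalf n - j.+1)).

Lemma winning_term_bound n i j : `|winning_term n i j| <= 1 + c ^+ 2.
Proof.
have a0 := diag_weight_gt0 rho; have a1 := diag_weight_lt1 rho.
rewrite ger0_norm ?walk2_scaled_bound //.
by rewrite mulr_ge0 ?walk2_ge0 // ltW // llt_scale_gt0.
Qed.

(** The first distance is [i + j + 1] for odd [n] and [i + j + 2] for even [n]. Adding the two laws
    covers both cases at once: the one of the wrong parity is 0, and exactly one parity indicator is
    1. *)
Lemma winning_term_cvg i j : winning_term n i j @[n --> \oo] --> c / pi.
Proof.
have a0 := diag_weight_gt0 rho; have a1 := diag_weight_lt1 rho.
set L := c / pi; pose d := dist i j.
pose F k n : R := llt_scale R n * walk2 a n k d - L * (~~ odd (n + k + d))%:R.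
have hL : (fun n => F (i + j + 1)%N n + F (i + j + 2)%N n + L) @ \oo --> 0 + 0 + L.
  by apply: cvgD; [apply: cvgD; exact: walk2_cvg|exact: cvg_cst].
rewrite !add0r in hL; apply: cvg_trans hL; apply: near_eq_cvg.
(* For such [n] the truncated subtractions in [winning_term] are exact. *)
have := near_uphalf_ge (i + j + 1); apply: filterS => n hn.
rewrite /F /winning_term.
have -> : dist (uphalf n - i.+1) (uphalf n - j.+1) = d by rewrite /d /dist; lia.
have [on|en] := boolP (odd n).
  have -> : dist (uphalf n - i.+1 + (uphalf n - j.+1)) n = (i + j + 1)%N.
    by rewrite /dist; lia.
  rewrite [walk2 a n (i + j + 2) d]walk2_odd; last by rewrite /d /dist; lia.
  have -> : odd (n + (i + j + 2) + d) = true by rewrite /d /dist; lia.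
  have -> : odd (n + (i + j + 1) + d) = false by rewrite /d /dist; lia.
  by rewrite /= -/L; ring.
have -> : dist (uphalf n - i.+1 + (uphalf n - j.+1)) n = (i + j + 2)%N.
  by rewrite /dist; lia.
rewrite [walk2 a n (i + j + 1) d]walk2_odd; last by rewrite /d /dist; lia.
have -> : odd (n + (i + j + 1) + d) = true by rewrite /d /dist; lia.
have -> : odd (n + (i + j + 2) + d) = false by rewrite /d /dist; lia.
by rewrite /= -/L; ring.
Qed.

Lemma zeta1_lt1 : 0 <= z1 < 1.
Proof. by rewrite expR_ge0 expR_lt1 /tau1 /=; have := rho0; lra. Qed.

Lemma zeta2_lt1 : 0 <= z2 < 1.
Proof. by rewrite expR_ge0 expR_lt1 /tau2 /=; have := rho0; lra. Qed.

Definition winning_sum (n : nat) : R :=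
  \sum_(i < uphalf n) z1 ^+ i * \sum_(j < uphalf n) z2 ^+ j * winning_term n i j.

(** Dominated convergence applied twice: the inner sums converge and are bounded by
    [(1 + c ^+ 2) / (1 - z2)], as the outer application requires. *)
Lemma winning_sum_cvg : winning_sum @ \oo --> c / pi / (1 - z2) / (1 - z1).
Proof.
apply: (@geometric_tannery _ z1 ((1 + c ^+ 2) / (1 - z2)) _
  (fun n i => \sum_(j < uphalf n) z2 ^+ j * winning_term n i j)).
- exact: zeta1_lt1.
- move=> n i; rewrite -(big_mkord xpredT (fun j => z2 ^+ j * winning_term n i j)).
  rewrite -[X in X / _]mulr1 -[X in _ * X / _](expr0 z2).
  by apply: geometric_sum_bound => //; [exact: zeta2_lt1|move=> j; exact: winning_term_bound].
- move=> i; apply: (@geometric_tannery _ z2 (1 + c ^+ 2) _ (fun n => winning_term n i)).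
  + exact: zeta2_lt1.
  + by move=> n j; exact: winning_term_bound.
  + by move=> j; exact: winning_term_cvg.
  + exact: near_uphalf_ge.
exact: near_uphalf_ge.
Qed.

Lemma prob_cw3_winning_sum n : (0 < n)%N -> prob_cw3 rho n =
  P ^+ n / (z1 ^ half_exp n * z2 ^ half_exp n) * (winning_sum n / llt_scale R n).
Proof.
move=> n0; rewrite prob_cw3E.
have z1n : z1 != 0 by rewrite gt_eqF ?expR_gt0.
have z2n : z2 != 0 by rewrite gt_eqF ?expR_gt0.
have ln := llt_scale_gt0 R n.
(* Since [n] is positive, the integer exponent is a natural number; at [n = 0] it would be -1. *)
have -> : half_exp n = (uphalf n).-1 by rewrite /half_exp; lia.
rewrite -!exprnP -mulrA; congr (_ * _).
rewrite /winning_sum mulrA mulr_sumr mulr_suml; apply: eq_bigr => -[i /= im] _.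
rewrite !mulr_sumr mulr_suml; apply: eq_bigr => -[j /= jm] _.
rewrite /winning_term.
have E z k : z != 0 -> (k < uphalf n)%N ->
    z ^- (uphalf n - k.+1) = z ^+ k / z ^+ (uphalf n).-1 :> R.
  move=> z0 km; have -> : (uphalf n).-1 = (k + (uphalf n - k.+1))%N by lia.
  by rewrite exprD invfM mulrA divff ?mul1r // expf_neq0.
rewrite !E //.
move: (walk2 _ _ _ _) (z1 ^+ i) (z2 ^+ j) => w u v.
have : z1 ^+ (uphalf n).-1 != 0 by rewrite expf_neq0.
have : z2 ^+ (uphalf n).-1 != 0 by rewrite expf_neq0.
move: (z1 ^+ _) (z2 ^+ _) (llt_scale R n) ln => p q l l0 q0 p0.
by field; rewrite p0 q0 gt_eqF.
Qed.

End Weighted.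
End Assembly.

Theorem theorem2 (R : realType) (rho : R) : 0 < rho ->
  [/\ Ppoly rho (zeta1 rho) (zeta2 rho) =
        2 * expR (- (2 * rho)) * (1 + expR (- (rho / 2)) + expR (- rho)) /
        ((1 + expR (- rho)) * (1 + expR (- rho) + expR (- (2 * rho)))),
      \det (hessian (Kfun rho) (tau1 rho) (tau2 rho)) =
        4^-1 * (expR (- (rho / 2)) * (1 + expR (- rho)) /
                (1 + expR (- (rho / 2)) + expR (- rho)) ^+ 2)
    & (fun n : nat => prob_cw3 rho n) ~_(\oo%classic)
      (fun n : nat =>
         Ppoly rho (zeta1 rho) (zeta2 rho) ^+ n /
         ((1 - zeta1 rho) * zeta1 rho ^ half_exp n *
          ((1 - zeta2 rho) * zeta2 rho ^ half_exp n)) *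
         (2 * pi * n%:R *
          Num.sqrt (\det (hessian (Kfun rho) (tau1 rho) (tau2 rho))))^-1)].
Proof.
have a0 := diag_weight_gt0 rho; have a1 := diag_weight_lt1 rho.
have d0 := diag_weight_denom_gt0 rho.
have detE := det_hessian rho.
move=> rho0; split.
- by rewrite Ppoly_zeta mallows_norm_half (expR_rho rho) (expR_2rho rho).
- by rewrite detE /diag_weight (expR_rho rho); field; rewrite gt_eqF.
have [z10 z11] := andP (zeta1_lt1 rho0); have [z20 z21] := andP (zeta2_lt1 rho0).
set D := Num.sqrt (\det _).
have DE : D = 2^-1 * Num.sqrt (diag_weight rho * (1 - diag_weight rho)).
  rewrite /D detE sqrtrM ?invr_ge0 //; congr (_ * _).
  by rewrite (_ : 4^-1 = 2^-1 ^+ 2) ?sqrtr_sqr ?ger0_norm ?invr_ge0 //; field.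
have S0 : 0 < Num.sqrt (diag_weight rho * (1 - diag_weight rho)).
  by rewrite sqrtr_gt0 mulr_gt0 // subr_gt0.
have D0 : D != 0 by rewrite DE mulf_neq0 ?invr_eq0 ?gt_eqF.
have w1 : 1 - zeta1 rho != 0 by rewrite subr_eq0 gt_eqF.
have w2 : 1 - zeta2 rho != 0 by rewrite subr_eq0 gt_eqF.
have pi0 := lt0r_neq0 (pi_gt0 R).
(* The inverse of the limit of [winning_sum], because [D] is half of [Num.sqrt (a * (1 - a))] for
   the diagonal weight [a]. *)
pose k := (1 - zeta1 rho) * (1 - zeta2 rho) * (2 * pi * D).
apply: (@equiv_of_ratio _ _ _ (fun n =>
  winning_sum rho n * (n%:R / llt_scale R n) * k)).
  have kE : (Num.sqrt (diag_weight rho * (1 - diag_weight rho)))^-1 / pi /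
      (1 - zeta2 rho) / (1 - zeta1 rho) * 1 * k = 1.
    rewrite /k DE; move: (Num.sqrt _) S0 => x /lt0r_neq0 x0.
    move: pi pi0 => y y0; move: (1 - zeta1 rho) (1 - zeta2 rho) w1 w2 => u v u0 v0.
    by field; rewrite x0 y0 u0 v0.
  rewrite -[X in (_ --> X)%classic]kE; apply: cvgMl.
  apply: cvgM; [exact: winning_sum_cvg | exact: nat_div_llt_scale_cvg].
exists 1%N => // n /= n0; rewrite prob_cw3_winning_sum // /k.
have nn : n%:R != 0 :> R by rewrite pnatr_eq0 -lt0n.
have ln := lt0r_neq0 (llt_scale_gt0 R n).
have p1 : zeta1 rho ^ half_exp n != 0 by rewrite expfz_neq0 // gt_eqF ?expR_gt0.
have p2 : zeta2 rho ^ half_exp n != 0 by rewrite expfz_neq0 // gt_eqF ?expR_gt0.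
move: (1 - zeta1 rho) (1 - zeta2 rho) w1 w2 => u v u0 v0.
move: pi pi0 => y y0.
move: (zeta1 rho ^ _) (zeta2 rho ^ _) (llt_scale R n) (n%:R) p1 p2 ln nn
  (winning_sum rho n) (Ppoly _ _ _ ^+ n) => p q l m p0 q0 l0 m0 w P.
move: (D) D0 => r r0.
by field; rewrite p0 q0 l0 m0 u0 v0 y0 r0.
Qed.
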